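(* Given $M\in\mathbb{Q}^{d\times d}$, $q\in\mathbb{Q}^d$, a polynomial weight function $w\colon\mathbb{R}^d\to\mathbb{R}$ with rational coefficients, and a discount factor $\delta\in(0,1)\cap\mathbb{Q}$, it is decidable whether the total reward $\sum_{k=0}^\infty w(M^kq)$ converges, and it is decidable whether the total discounted reward $\sum_{k=0}^\infty\delta^k\cdot w(M^kq)$ converges; in case of convergence, the respective value is rational and effectively computable.
   Context: ''Decidable'' and ''effectively computable'' mean that there is an algorithm taking $(M,q,w,\delta)$ as input. Convergence of a series means convergence of its partial sums to a real number. *)

(* Defs.v *)
From mathcomp Require Import all_boot all_order all_algebra.
From mathcomp Require Import all_classical all_reals all_analysis.
(* The notations of mpoly clash with those of the analysis library. *)
From mathcomp Require Import -(notations) mpoly.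

Set Implicit Arguments.
Unset Strict Implicit.
Unset Printing Implicit Defensive.

Import Order.TTheory GRing.Theory Num.Theory.

Local Open Scope ring_scope.

(* "Algorithm" means partial recursive (mu-recursive) function on naturals.
   Arities are not tracked: an argument list that is too short is read as
   padded with zeros by [Succ] and [Proj]; [Prec] is undefined on [::]. *)
Inductive recfun : Type :=
  | Zero
  | Succ
  | Proj of nat
  | Comp of recfun & seq recfun
  | Prec of recfun & recfun
  | Mu of recfun.

(* [evaluates e xs y]: the computation of [e] on [xs] halts with result [y]. *)
Inductive evaluates : recfun -> seq nat -> nat -> Prop :=
  | eval_zero xs : evaluates Zero xs 0%N
  | eval_succ xs : evaluates Succ xs (nth 0%N xs 0).+1
  | eval_proj i xs : evaluates (Proj i) xs (nth 0%N xs i)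
  | eval_comp f gs xs ys y :
      size ys = size gs ->
      (forall i, (i < size gs)%N ->
         evaluates (nth Zero gs i) xs (nth 0%N ys i)) ->
      evaluates f ys y ->
      evaluates (Comp f gs) xs y
  | eval_prec0 f g xs y :
      evaluates f xs y ->
      evaluates (Prec f g) (0%N :: xs) y
  | eval_precS f g n xs r y :
      evaluates (Prec f g) (n :: xs) r ->
      evaluates g [:: n, r & xs] y ->
      evaluates (Prec f g) (n.+1 :: xs) y
  | eval_mu f xs n (v : nat -> nat) :
      (forall i, (i < n)%N -> evaluates f (i :: xs) (v i).+1) ->
      evaluates f (n :: xs) 0%N ->
      evaluates (Mu f) xs n.

(* Finite data are coded by naturals through [CodeSeq.code], MathComp's
   bijection [seq nat -> nat], sending [n :: s] to 2 ^ n * (2 * code s + 1). *)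
Definition encode_int (z : int) : nat :=
  match z with
  | Posz n => n.*2
  | Negz n => n.*2.+1
  end.

Definition encode_rat (r : rat) : nat :=
  CodeSeq.code [:: encode_int (numq r); encode_int (denq r)].

Definition encode_mx (m n : nat) (A : 'M[rat]_(m, n)) : nat :=
  CodeSeq.code [seq encode_rat (A i j) | i <- enum 'I_m, j <- enum 'I_n].

(* A polynomial is presented to an algorithm as a finite list of terms
   (coefficient, exponent vector); repeated monomials and zero coefficients
   are allowed. *)
Definition terms (d : nat) : Type := seq (rat * d.-tuple nat).

Definition poly_of_terms (d : nat) (ts : terms d) : mpoly d rat :=
  \sum_(t <- ts) t.1 *: mpolyX rat (Multinom t.2).

Definition encode_terms (d : nat) (ts : terms d) : nat :=
  CodeSeq.code
    [seq CodeSeq.code [:: encode_rat t.1; CodeSeq.code (tval t.2)] | t <- ts].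

Definition encode_input (d : nat) (M : 'M[rat]_d) (q : 'cV[rat]_d)
    (ts : terms d) (delta : rat) : seq nat :=
  [:: d; encode_mx M; encode_mx q; encode_terms ts; encode_rat delta].

Definition weight (R : realType) (d : nat) (w : mpoly d rat)
    (x : 'cV[R]_d) : R :=
  mmap (ratr : rat -> R) (fun i : 'I_d => x i 0) w.

Definition reward (R : realType) (d : nat) (M : 'M[rat]_d) (q : 'cV[rat]_d)
    (w : mpoly d rat) (k : nat) : R :=
  weight w (map_mx (ratr : rat -> R) M ^+ k *m map_mx (ratr : rat -> R) q).

Definition discounted_reward (R : realType) (d : nat) (M : 'M[rat]_d)
    (q : 'cV[rat]_d) (w : mpoly d rat) (delta : rat) (k : nat) : R :=
  ratr delta ^+ k * reward R M q w k.

Definition decides (e : recfun) (input : seq nat) (P : Prop) : Prop :=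
  exists b : bool, evaluates e input (nat_of_bool b) /\ (b <-> P).

Definition computes_rational (R : realType) (e : recfun) (input : seq nat)
    (x : R) : Prop :=
  exists r : rat, x = ratr r /\ evaluates e input (encode_rat r).

(* Main.v *)
Require Import Defs.
From mathcomp Require Import all_boot all_order all_algebra ring lra archimedean.
From mathcomp Require Import all_classical all_reals all_analysis.
From mathcomp Require Import -(notations) mpoly.

Set Implicit Arguments.
Unset Strict Implicit.
Unset Printing Implicit Defensive.

Import Order.TTheory GRing.Theory Num.Theory.
Import numFieldNormedType.Exports.
Local Open Scope ring_scope.

(* The rewards [a_k] form a rational linear recurrence sequence whose order [N]
   is bounded in terms of the input, and so do the discounted rewards. For such
   a sequence, convergence of the series and [a_k -> 0] are equivalent, and both
   sides of the alternative have finite certificates: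
   - [a_k -> 0]: some recurrence [a_(k+n) = \sum_(i < n) c_i a_(k+i)] has
     [\sum_i `|c_i| < 1]; it makes the series absolutely convergent, and summing
     it over [k] gives the value;
   - otherwise: a bilinear form [B] on the span of the shifts of [a], with
     [B(f, g) - B(Sf, Sg) = f_0 g_0] for the shift [S] but [B(f, f) < 0] for some
     [f], or with [B(f, g) = B(Sf, Sg)] but [B <> 0]. Both are impossible when
     [S^k] tends to zero. One of them exists by linear algebra over the rationals
     because a form [B >= 0] of the first kind bounds [\sum_k a_k ^ 2] by [B(a, a)].
   An identity between recurrence sequences of order [N] need only be checked on
   the first [N] indices, so both kinds of certificates can be verified, and an
   unbounded search finds one of them. *)

(** * Computability *)

Local Open Scope nat_scope.

Class coded (T : Type) := encode : T -> nat.
#[global] Instance coded_nat : coded nat := fun n => n.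
#[global] Instance coded_bool : coded bool := nat_of_bool.
#[global] Instance coded_rat : coded rat := encode_rat.
#[global] Instance coded_seq T (cT : coded T) : coded (seq T) :=
  fun s => CodeSeq.code (map encode s).
#[global] Instance coded_pair T U (cT : coded T) (cU : coded U) : coded (T * U) :=
  fun p => CodeSeq.code [:: encode p.1; encode p.2].

(* The argument list on which a function of [x : X] is evaluated. Binding one
   more variable of type [T] amounts to passing from [X] to [T * X]. *)
Class context (X : Type) := Context {
  arity : nat;
  args : X -> seq nat;
  size_args : forall x, size (args x) = arity }.
#[global] Instance context_ext T X (cT : coded T) (cX : context X) :
  context (T * X) :=
  @Context (T * X) (arity (X := X)).+1 (fun p => encode p.1 :: args p.2)
    (fun p => congr1 succn (size_args p.2)).

Definition computable X T {cX : context X} {cT : coded T} (f : X -> T) :=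
  exists e, forall x, evaluates e (args x) (encode (f x)).

(** Substitutions between argument lists: one program for each target argument, so that
    precomposition is a single [Comp]. *)
Definition ctxmap X Y {cX : context X} {cY : context Y} (h : X -> Y) :=
  exists gs : seq recfun, size gs = arity (X := Y) /\
    forall x i, i < arity (X := Y) ->
      evaluates (nth Zero gs i) (args x) (nth 0 (args (h x)) i).

Lemma computable_ext X T (cX : context X) (cT : coded T) (f g : X -> T) :
  f =1 g -> computable g -> computable f.
Proof. by move=> fg [e He]; exists e => x; rewrite fg. Qed.

(** Naturals are coded by themselves, so passing between a value and its code is a conversion. *)
Lemma computable_encode X T (cX : context X) (cT : coded T) (f : X -> T) :
  computable (fun x => encode (f x)) -> computable f.
Proof. by []. Qed.

Lemma computable_encoded X T (cX : context X) (cT : coded T) (f : X -> T) :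
  computable f -> computable (fun x => encode (f x)).
Proof. by []. Qed.

Lemma ctxmap_comp X Y Z (cX : context X) (cY : context Y) (cZ : context Z)
    (g : Y -> Z) (h : X -> Y) :
  ctxmap g -> ctxmap h -> ctxmap (fun x => g (h x)).
Proof.
move=> [gs [sgs Hgs]] [hs [shs Hhs]].
exists [seq Comp e hs | e <- gs]; split; first by rewrite size_map.
move=> x i ilt; rewrite (nth_map Zero) ?sgs //.
apply: (@eval_comp _ _ _ (args (h x))); last exact: Hgs.
- by rewrite size_args.
- by move=> j; rewrite shs => jlt; exact: Hhs.
Qed.

Lemma computable_comp X Y T (cX : context X) (cY : context Y) (cT : coded T)
    (g : Y -> T) (h : X -> Y) :
  computable g -> ctxmap h -> computable (fun x => g (h x)).
Proof.
move=> [e He] [hs [shs Hhs]]; exists (Comp e hs) => x.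
apply: (@eval_comp _ _ _ (args (h x))); last exact: He.
- by rewrite size_args.
- by move=> j; rewrite shs => jlt; exact: Hhs.
Qed.

Lemma ctxmap_id X (cX : context X) : ctxmap (fun x : X => x).
Proof.
exists [seq Proj i | i <- iota 0 (arity (X := X))].
rewrite size_map size_iota; split=> // x i ilt.
by rewrite (nth_map 0) ?size_iota // nth_iota // add0n; constructor.
Qed.

Lemma ctxmap_snd0 T X (cT : coded T) (cX : context X) :
  ctxmap (fun p : T * X => p.2).
Proof.
exists [seq Proj i.+1 | i <- iota 0 (arity (X := X))].
rewrite size_map size_iota; split=> // -[t x] i ilt.
rewrite (nth_map 0) ?size_iota // nth_iota // add0n.
exact: (eval_proj i.+1 (args (t, x))).
Qed.

Lemma ctxmap_snd T X Y (cT : coded T) (cX : context X) (cY : context Y)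
    (h : Y -> T * X) :
  ctxmap h -> ctxmap (fun y => (h y).2).
Proof. exact: ctxmap_comp (ctxmap_snd0 _ _). Qed.

Lemma ctxmap_pair T X Y (cT : coded T) (cX : context X) (cY : context Y)
    (f : X -> T) (h : X -> Y) :
  computable f -> ctxmap h -> ctxmap (fun x => (f x, h x)).
Proof.
move=> [e He] [gs [sgs Hgs]]; exists (e :: gs); split; first by rewrite /= sgs.
by move=> x [|i] //=; rewrite ltnS; exact: Hgs.
Qed.

Lemma computable_fst T X Y (cT : coded T) (cX : context X) (cY : context Y)
    (h : Y -> T * X) :
  ctxmap h -> computable (fun y => (h y).1).
Proof.
move=> ch; apply: (computable_comp _ ch (g := fun p => p.1)).
by exists (Proj 0) => x; exact: (eval_proj 0).
Qed.

Section Recursion.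
Context {X : Type} {cX : context X}.

Lemma computable_succ (f : X -> nat) :
  computable f -> computable (fun x => (f x).+1).
Proof.
move=> [e He]; exists (Comp Succ [:: e]) => x.
apply: (@eval_comp _ _ _ [:: f x]) => //; last exact: (eval_succ [:: f x]).
by case=> // _; exact: He.
Qed.

Lemma computable_const T {cT : coded T} (t : T) : computable (fun _ : X => t).
Proof.
apply: computable_encode; elim: (encode t) => [|n IH]; last exact: computable_succ.
by exists Zero => x; constructor.
Qed.

(** Primitive recursion: [Prec] hands its step the counter, the previous value and the arguments,
    which is the argument list of the context [nat * (T * X)]. *)
Lemma computable_iteri T (cT : coded T) (n : X -> nat) (b : X -> T)
    (s : nat -> T -> X -> T) :
  computable n -> computable b ->
  computable (fun p : nat * (T * X) => s p.1 p.2.1 p.2.2) ->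
  computable (fun x => iteri (n x) (fun i r => s i r x) (b x)).
Proof.
move=> [en Hn] [eb Hb] [es Hs].
have [gs [sgs Hgs]] := ctxmap_id cX.
exists (Comp (Prec eb es) (en :: gs)) => x.
apply: (@eval_comp _ _ _ (n x :: args x)).
- by rewrite /= sgs size_args.
- by case=> [|i] /=; [move=> _; exact: Hn | rewrite sgs; exact: Hgs].
elim: (n x) => [|m IH] /=; first exact: eval_prec0.
by apply: (eval_precS IH); exact: (Hs (m, (_, x))).
Qed.

Lemma computable_if T (cT : coded T) (b : X -> bool) (f g : X -> T) :
  computable b -> computable f -> computable g ->
  computable (fun x => if b x then f x else g x).
Proof.
move=> cb cf cg.
(* A case distinction is an iteration performed once or not at all. *)
apply: (@computable_ext _ _ _ _ _
  (fun x => iteri (nat_of_bool (b x)) (fun _ _ => f x) (g x))).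
  by move=> x; case: (b x).
apply: (computable_iteri (s := fun _ _ => f) cb cg).
by apply: (computable_comp cf); do 2!apply: ctxmap_snd; exact: ctxmap_id.
Qed.

End Recursion.

Ltac ctxmap_tac :=
  repeat first [ exact: ctxmap_id | apply: ctxmap_snd | apply: ctxmap_snd0 ].

Lemma computable_negb X (cX : context X) (f : X -> bool) :
  computable f -> computable (fun x => ~~ f x).
Proof.
move=> cf; apply: (computable_if cf); exact: computable_const.
Qed.

Lemma computable_andb X (cX : context X) (f g : X -> bool) :
  computable f -> computable g -> computable (fun x => f x && g x).
Proof.
by move=> cf cg; apply: (computable_if cf cg); exact: computable_const.
Qed.

Lemma computable_orb X (cX : context X) (f g : X -> bool) :
  computable f -> computable g -> computable (fun x => f x || g x).
Proof.
by move=> cf cg; apply: (computable_if cf _ cg); exact: computable_const.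
Qed.

Lemma computable_search X (cX : context X) (P : nat -> X -> bool) :
  computable (fun p : nat * X => P p.1 p.2) -> (forall x, exists n, P n x) ->
  exists2 f : X -> nat, computable f &
    forall x, P (f x) x /\ forall j, j < f x -> ~~ P j x.
Proof.
move=> cP exP; pose f x := ex_minn (exP x).
have fP x : P (f x) x /\ forall j, j < f x -> ~~ P j x.
  rewrite /f; case: ex_minnP => n Pn minn; split=> // j jn.
  by apply: contraTN jn => /minn; rewrite -leqNgt.
exists f => //.
(* [Mu] looks for a zero, so truth becomes 0 and falsity 1. *)
have [||e He] := @computable_if _ _ _ _ (fun p : nat * X => P p.1 p.2)
  (fun=> 0) (fun=> 1) cP; try exact: computable_const.
exists (Mu e) => x; have [Pf minf] := fP x.
apply: (@eval_mu _ _ _ (fun=> 0)) => [i /minf/negbTE Pi|].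
  by have := He (i, x); rewrite /= Pi.
by have := He (f x, x); rewrite /= Pf.
Qed.

(** The search stops at the least solution, which is [h x]. Quotients, heads and lengths of coded
    lists and reduced denominators are programmed this way. *)
Lemma computable_least X (cX : context X) (P : nat -> X -> bool) (h : X -> nat) :
  computable (fun p : nat * X => P p.1 p.2) ->
  (forall x, P (h x) x) -> (forall x n, P n x -> h x <= n) -> computable h.
Proof.
move=> cP Ph hP; have [|f cf fP] := computable_search cP; first by eexists.
apply: computable_ext cf => x; have [Pf minf] := fP x.
apply/eqP; rewrite eqn_leq hP //= leqNgt.
by apply/negP => /minf; rewrite Ph.
Qed.

(** * Arithmetic on natural numbers *)

Lemma computable_addn X (cX : context X) (f g : X -> nat) :
  computable f -> computable g -> computable (fun x => f x + g x).
Proof.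
move=> cf cg; apply: (@computable_ext _ _ _ _ _
  (fun x => iteri (f x) (fun _ r => r.+1) (g x))).
  by move=> x; elim: (f x) => //= n <-.
apply: (computable_iteri (s := fun _ r _ => r.+1)) => //.
by apply: computable_succ; apply: computable_fst; ctxmap_tac.
Qed.

Lemma computable_muln X (cX : context X) (f g : X -> nat) :
  computable f -> computable g -> computable (fun x => f x * g x).
Proof.
move=> cf cg; apply: (@computable_ext _ _ _ _ _
  (fun x => iteri (f x) (fun _ r => g x + r) 0)).
  by move=> x; elim: (f x) => //= n <-.
apply: (computable_iteri (s := fun _ r x => g x + r)) => //.
  exact: computable_const.
apply: computable_addn; last by apply: computable_fst; ctxmap_tac.
by apply: (computable_comp cg); ctxmap_tac.
Qed.

Lemma computable_expn X (cX : context X) (f g : X -> nat) :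
  computable f -> computable g -> computable (fun x => f x ^ g x).
Proof.
move=> cf cg; apply: (@computable_ext _ _ _ _ _
  (fun x => iteri (g x) (fun _ r => f x * r) 1)).
  by move=> x; elim: (g x) => //= n <-; rewrite expnS.
apply: (computable_iteri (s := fun _ r x => f x * r)) => //.
  exact: computable_const.
apply: computable_muln; last by apply: computable_fst; ctxmap_tac.
by apply: (computable_comp cf); ctxmap_tac.
Qed.

Lemma computable_pred X (cX : context X) (f : X -> nat) :
  computable f -> computable (fun x => (f x).-1).
Proof.
move=> cf; apply: (@computable_ext _ _ _ _ _
  (fun x => iteri (f x) (fun i _ => i) 0)).
  by move=> x; case: (f x).
apply: (computable_iteri (s := fun i _ _ => i)) => //.
  exact: computable_const.
by apply: computable_fst; ctxmap_tac.
Qed.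

Lemma computable_odd X (cX : context X) (f : X -> nat) :
  computable f -> computable (fun x => odd (f x)).
Proof.
move=> cf; apply: (@computable_ext _ _ _ _ _
  (fun x => iteri (f x) (fun _ b => ~~ b) false)).
  by move=> x; elim: (f x) => //= n ->.
apply: (computable_iteri (s := fun _ b _ => ~~ b)) => //.
  exact: computable_const.
by apply: computable_negb; apply: computable_fst; ctxmap_tac.
Qed.

Lemma computable_subn X (cX : context X) (f g : X -> nat) :
  computable f -> computable g -> computable (fun x => f x - g x).
Proof.
move=> cf cg; apply: (@computable_ext _ _ _ _ _
  (fun x => iteri (g x) (fun _ r => r.-1) (f x))).
  by move=> x; elim: (g x) => [|n /= <-]; rewrite ?subn0 ?subnS.
apply: (computable_iteri (s := fun _ r _ => r.-1)) => //.
by apply: computable_pred; apply: computable_fst; ctxmap_tac.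
Qed.

Lemma computable_eq0 X (cX : context X) (f : X -> nat) :
  computable f -> computable (fun x => f x == 0).
Proof.
move=> cf; apply: (@computable_ext _ _ _ _ _
  (fun x => iteri (f x) (fun _ _ => false) true)).
  by move=> x; case: (f x).
apply: (computable_iteri (s := fun _ _ _ => false)) => //; exact: computable_const.
Qed.

Lemma computable_leq X (cX : context X) (f g : X -> nat) :
  computable f -> computable g -> computable (fun x => f x <= g x).
Proof. by move=> cf cg; apply: computable_eq0; apply: computable_subn. Qed.

Lemma computable_ltn X (cX : context X) (f g : X -> nat) :
  computable f -> computable g -> computable (fun x => f x < g x).
Proof. by move=> cf cg; apply: computable_leq => //; apply: computable_succ. Qed.

Lemma computable_eqn X (cX : context X) (f g : X -> nat) :
  computable f -> computable g -> computable (fun x => f x == g x).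
Proof.
move=> cf cg; apply: (@computable_ext _ _ _ _ _
  (fun x => (f x <= g x) && (g x <= f x))).
  by move=> x; rewrite eqn_leq.
by apply: computable_andb; apply: computable_leq.
Qed.

Lemma computable_eq X (cX : context X) (T : eqType) (cT : coded T) (f g : X -> T) :
  injective (encode (T := T)) -> computable f -> computable g ->
  computable (fun x => f x == g x).
Proof.
move=> inj_enc cf cg.
have := computable_eqn (computable_encoded cf) (computable_encoded cg).
by apply: computable_ext => x; rewrite (inj_eq inj_enc).
Qed.

Lemma computable_divn X (cX : context X) (f g : X -> nat) :
  computable f -> computable g -> (forall x, 0 < g x) ->
  computable (fun x => f x %/ g x).
Proof.
move=> cf cg g_gt0.
apply: (computable_least (P := fun n x => f x < n.+1 * g x)).
- apply: computable_ltn; first by apply: (computable_comp cf); ctxmap_tac.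
  apply: computable_muln; last by apply: (computable_comp cg); ctxmap_tac.
  by apply: computable_succ; apply: computable_fst; ctxmap_tac.
- by move=> x; apply: ltn_ceil.
- by move=> x n; rewrite -ltn_divLR.
Qed.

Lemma computable_big X (cX : context X) T (cT : coded T) (op : T -> T -> T) (idx : T)
    (F : nat -> X -> T) (n : X -> nat) :
  (forall Y (cY : context Y) (f g : Y -> T),
     computable f -> computable g -> computable (fun y => op (f y) (g y))) ->
  computable (fun p : nat * X => F p.1 p.2) -> computable n ->
  computable (fun x => \big[op/idx]_(0 <= i < n x) F i x).
Proof.
move=> cop cF cn.
(* No associativity of [op] is assumed, so the right-nested fold is built outwards from its
   innermost term, the one of last index. *)
apply: (@computable_ext _ _ _ _ _
  (fun x => iteri (n x) (fun i r => op (F (n x - i.+1) x) r) idx)).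
  move=> x; suff H m : m <= n x ->
      iteri m (fun i r => op (F (n x - i.+1) x) r) idx
      = \big[op/idx]_(n x - m <= i < n x) F i x.
    by rewrite H // subnn.
  elim: m => [|m IH] mn; first by rewrite subn0 big_geq.
  rewrite /= IH 1?ltnW // [RHS]big_ltn; last by rewrite ltn_subrL (leq_ltn_trans _ mn).
  by rewrite subnSK.
apply: (computable_iteri (s := fun i r x => op (F (n x - i.+1) x) r)) => //.
  exact: computable_const.
apply: cop; last by apply: computable_fst; ctxmap_tac.
have c2 : ctxmap (fun p : nat * (T * X) => p.2.2) by ctxmap_tac.
apply: (computable_comp cF (h := fun p : nat * (T * X) => (n p.2.2 - p.1.+1, p.2.2))).
apply: ctxmap_pair => //; apply: computable_subn; first exact: computable_comp c2.
by apply: computable_succ; apply: computable_fst; ctxmap_tac.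
Qed.

Lemma computable_all X (cX : context X) (P : nat -> X -> bool) (n : X -> nat) :
  computable (fun p : nat * X => P p.1 p.2) -> computable n ->
  computable (fun x => all (P^~ x) (iota 0 (n x))).
Proof.
move=> cP cn; apply: (@computable_ext _ _ _ _ _
  (fun x => \big[andb/true]_(0 <= i < n x) P i x)).
  by move=> x; rewrite /index_iota subn0 big_all.
by apply: computable_big => // Y cY f g; apply: computable_andb.
Qed.

(** * Lists and rationals *)

Lemma code_cons n s : CodeSeq.code (n :: s) = 2 ^ n * (CodeSeq.code s).*2.+1.
Proof. by []. Qed.

(** The head of a nonempty list is the exponent of 2 in its code. The empty list has code 0 and
    default head 0, which the first disjunct covers. *)
Lemma computable_code_head X (cX : context X) (s : X -> seq nat) :
  computable (fun x => CodeSeq.code (s x)) -> computable (fun x => head 0 (s x)).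
Proof.
move=> cs; apply: (computable_least
  (P := fun n x => (CodeSeq.code (s x) == 0) || odd (CodeSeq.code (s x) %/ 2 ^ n))).
- apply: computable_orb.
    by apply: computable_eq0; apply: (computable_comp cs); ctxmap_tac.
  apply: computable_odd; apply: computable_divn => [|| p].
  + by apply: (computable_comp cs); ctxmap_tac.
  + by apply: computable_expn; [exact: computable_const | apply: computable_fst; ctxmap_tac].
  + by rewrite expn_gt0.
- move=> x; case: (s x) => [|n t] //; rewrite code_cons mulKn ?expn_gt0 //=.
  by rewrite odd_double orbT.
- move=> x n; case: (s x) => [|m t] //; rewrite code_cons muln_eq0 /= orbF.
  rewrite expn_eq0 /= leqNgt; apply: contraL => nm.
  by rewrite -(subnK (ltnW nm)) expnD mulnAC mulnK ?expn_gt0 //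
             oddM oddX /= subn_eq0 leqNgt nm.
Qed.

Lemma computable_code_behead X (cX : context X) (s : X -> seq nat) :
  computable (fun x => CodeSeq.code (s x)) ->
  computable (fun x => CodeSeq.code (behead (s x))).
Proof.
(* Dividing by [2 ^ n] leaves an odd number, and halving that drops its final bit; the code 0 of the
   empty list stays 0. *)
move=> cs; apply: (@computable_ext _ _ _ _ _
  (fun x => CodeSeq.code (s x) %/ 2 ^ (head 0 (s x)).+1)).
  move=> x; case: (s x) => [|n t]; first by rewrite div0n.
  rewrite code_cons /= expnSr divnMA mulKn ?expn_gt0 //.
  by rewrite divn2 /= uphalf_double.
apply: computable_divn => // [|x]; last by rewrite expn_gt0.
apply: computable_expn; first exact: computable_const.
by apply: computable_succ; apply: computable_code_head.
Qed.

Lemma computable_code_cons X (cX : context X) (f : X -> nat) (s : X -> seq nat) :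
  computable f -> computable (fun x => CodeSeq.code (s x)) ->
  computable (fun x => CodeSeq.code (f x :: s x)).
Proof.
move=> cf cs; rewrite /CodeSeq.code /=.
apply: computable_muln; first by apply: computable_expn => //; exact: computable_const.
apply: computable_succ; apply: (@computable_ext _ _ _ _ _
  (fun x => 2 * CodeSeq.code (s x))); first by move=> x; rewrite mul2n.
by apply: computable_muln => //; exact: computable_const.
Qed.

Lemma computable_behead X (cX : context X) T (cT : coded T) (s : X -> seq T) :
  computable s -> computable (fun x => behead (s x)).
Proof.
move=> cs; have := @computable_code_behead _ _ (fun x => map encode (s x)) cs.
by apply: computable_ext => x; rewrite behead_map.
Qed.

Lemma computable_nilp X (cX : context X) T (cT : coded T) (s : X -> seq T) :
  computable s -> computable (fun x => nilp (s x)).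
Proof.
move=> cs; have := computable_eq0 (computable_encoded cs).
apply: computable_ext => x; rewrite /encode /coded_seq.
by case: (s x) => [|t u] //; rewrite [map _ _]/= code_cons muln_eq0 expn_eq0.
Qed.

Lemma computable_head X (cX : context X) T (cT : coded T) (t0 : T) (s : X -> seq T) :
  computable s -> computable (fun x => head t0 (s x)).
Proof.
move=> cs; apply: (@computable_ext _ _ _ _ _ (fun x => head t0 (s x))) => //.
have := computable_if (computable_nilp cs) (computable_encoded (computable_const (X := X) t0))
  (@computable_code_head _ _ (fun x => map encode (s x)) cs).
by move=> [e He]; exists e => x; have := He x; case: (s x).
Qed.

Lemma computable_drop X (cX : context X) T (cT : coded T) (n : X -> nat) (s : X -> seq T) :
  computable n -> computable s -> computable (fun x => drop (n x) (s x)).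
Proof.
move=> cn cs; apply: (@computable_ext _ _ _ _ _
  (fun x => iteri (n x) (fun _ r => behead r) (s x))).
  by move=> x; elim: (n x) => [|m /= <-]; rewrite ?drop0 // -drop1 drop_drop add1n.
apply: (computable_iteri (s := fun _ r _ => behead r)) => //.
by apply: computable_behead; apply: computable_fst; ctxmap_tac.
Qed.

Lemma computable_nth X (cX : context X) T (cT : coded T) (t0 : T) (s : X -> seq T)
    (n : X -> nat) :
  computable s -> computable n -> computable (fun x => nth t0 (s x) (n x)).
Proof.
move=> cs cn; have := computable_head t0 (computable_drop cn cs).
by apply: computable_ext => x; rewrite -nth0 nth_drop addn0.
Qed.

Lemma computable_size X (cX : context X) T (cT : coded T) (s : X -> seq T) :
  computable s -> computable (fun x => size (s x)).
Proof.
move=> cs; apply: (computable_least (P := fun n x => nilp (drop n (s x)))).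
- apply: computable_nilp; apply: computable_drop; first by apply: computable_fst; ctxmap_tac.
  by apply: (computable_comp cs); ctxmap_tac.
- by move=> x; rewrite drop_size.
- by move=> x n; rewrite /nilp size_drop subn_eq0.
Qed.

Lemma computable_cons X (cX : context X) T (cT : coded T) (f : X -> T) (s : X -> seq T) :
  computable f -> computable s -> computable (fun x => f x :: s x).
Proof.
move=> cf cs.
exact: (@computable_code_cons _ _ (fun x => encode (f x)) (fun x => map encode (s x))).
Qed.

Lemma computable_mkseq X (cX : context X) T (cT : coded T) (F : nat -> X -> T)
    (n : X -> nat) :
  computable (fun p : nat * X => F p.1 p.2) -> computable n ->
  computable (fun x => mkseq (F^~ x) (n x)).
Proof.
move=> cF cn; apply: (@computable_ext _ _ _ _ _
  (fun x => iteri (n x) (fun i r => F (n x - i.+1) x :: r) [::])).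
  move=> x; suff H m : m <= n x ->
      iteri m (fun i r => F (n x - i.+1) x :: r) [::]
      = [seq F i x | i <- iota (n x - m) m].
    by rewrite H // subnn.
  elim: m => [|m IH] mn //=.
  by rewrite IH 1?ltnW // subnSK.
apply: (computable_iteri (s := fun i r x => F (n x - i.+1) x :: r)) => //.
  exact: computable_const.
apply: computable_cons; last by apply: computable_fst; ctxmap_tac.
have c2 : ctxmap (fun p : nat * (seq T * X) => p.2.2) by ctxmap_tac.
apply: (computable_comp cF (h := fun p : nat * (seq T * X) => (n p.2.2 - p.1.+1, p.2.2))).
apply: ctxmap_pair => //; apply: computable_subn; first exact: computable_comp c2.
by apply: computable_succ; apply: computable_fst; ctxmap_tac.
Qed.

Lemma computable_proj1 X (cX : context X) T U (cT : coded T) (cU : coded U)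
    (f : X -> T * U) :
  computable f -> computable (fun x => (f x).1).
Proof.
move=> cf.
exact: (@computable_code_head _ _ (fun x => [:: encode (f x).1; encode (f x).2]) cf).
Qed.

Lemma computable_proj2 X (cX : context X) T U (cT : coded T) (cU : coded U)
    (f : X -> T * U) :
  computable f -> computable (fun x => (f x).2).
Proof.
move=> cf; have := @computable_code_behead _ _ (fun x => [:: encode (f x).1; encode (f x).2]) cf.
exact: (@computable_code_head _ _ (fun x => [:: encode (f x).2])).
Qed.

Lemma computable_decode X (cX : context X) (f : X -> nat) :
  computable f -> computable (fun x => CodeSeq.decode (f x)).
Proof.
move=> [e He]; exists e => x; rewrite /encode /coded_seq map_id CodeSeq.decodeK.
exact: He.
Qed.

(** * Rational arithmetic through fractions of naturals *)

Local Open Scope ring_scope.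

Definition rat_pos (r : rat) : nat := if 0 <= r then `|numq r|%N else 0.
Definition rat_neg (r : rat) : nat := if 0 <= r then 0 else `|numq r|%N.
Definition rat_den (r : rat) : nat := `|denq r|%N.
(** Every triple of naturals is a fraction, not necessarily reduced: the signed numerator is a
    difference and the denominator is shifted by one. *)
Definition mkrat (p n d : nat) : rat := (p%:R - n%:R) / d.+1%:R.

Lemma rat_den_gt0 r : (0 < rat_den r)%N.
Proof. by rewrite absz_gt0 denq_neq0. Qed.

Lemma rat_denE r : (rat_den r).-1.+1%:R = (denq r)%:~R :> rat.
Proof. by rewrite prednK ?rat_den_gt0 // -[in RHS]absz_denq. Qed.

Lemma rat_split r : (rat_pos r)%:R - (rat_neg r)%:R = (numq r)%:~R :> rat.
Proof.
rewrite /rat_pos /rat_neg; case: ifPn => r0.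
  by rewrite subr0 -[numq r in RHS]gez0_abs // numq_ge0.
by rewrite sub0r -[numq r in RHS]opprK -[- numq r]lez0_abs ?intrN // numq_le0 ltW // ltNge.
Qed.

Lemma mkrat_rat r : mkrat (rat_pos r) (rat_neg r) (rat_den r).-1 = r.
Proof. by rewrite /mkrat rat_split rat_denE divq_num_den. Qed.

Lemma computable_half X (cX : context X) (f : X -> nat) :
  computable f -> computable (fun x => (f x)./2).
Proof.
move=> cf; have := computable_divn cf (computable_const (X := X) 2%N) (fun=> isT).
by apply: computable_ext => x; rewrite divn2.
Qed.

Section RatParts.
Context {X : Type} {cX : context X}.
Variable f : X -> rat.
Hypothesis cf : computable f.

Let cparts : computable (fun x => CodeSeq.code
  [:: encode_int (numq (f x)); encode_int (denq (f x))]).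
Proof. exact: cf. Qed.

Let cnum : computable (fun x => encode_int (numq (f x))).
Proof. exact: computable_code_head cparts. Qed.

Let odd_num x : odd (encode_int (numq (f x))) = ~~ (0 <= f x).
Proof.
rewrite -numq_ge0; case: (numq (f x)) => n /=; by rewrite odd_double.
Qed.

Lemma computable_rat_ge0 : computable (fun x => 0 <= f x).
Proof.
have := computable_negb (computable_odd cnum).
by apply: computable_ext => x; rewrite odd_num negbK.
Qed.

Let cabs : computable (fun x => `|numq (f x)|%N).
Proof.
(* The codes [2n] of [n] and [2n + 1] of [-(n + 1)] both give the absolute value as
   [(code + 1) / 2], rounded down. *)
have := computable_half (computable_succ cnum).
apply: computable_ext => x; case: (numq _) => n /=; first by rewrite uphalf_double.
by rewrite doubleK.
Qed.

Lemma computable_rat_pos : computable (fun x => rat_pos (f x)).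
Proof.
apply: computable_if => //; [exact: computable_rat_ge0 | exact: computable_const].
Qed.

Lemma computable_rat_neg : computable (fun x => rat_neg (f x)).
Proof.
apply: computable_if => //; [exact: computable_rat_ge0 | exact: computable_const].
Qed.

Lemma computable_rat_den : computable (fun x => rat_den (f x)).
Proof.
have := computable_half (computable_code_head (computable_code_behead cparts)).
apply: computable_ext => x; rewrite /rat_den /=.
by have := denq_gt0 (f x); case: (denq _) => // n _; rewrite /= doubleK.
Qed.

End RatParts.

Lemma numq_mkrat p n d :
  (`|numq (mkrat p n d)| * d.+1 = `|p%:Z - n%:Z| * rat_den (mkrat p n d))%N.
Proof.
have d0 : d.+1%:R != 0 :> rat by rewrite pnatr_eq0.
rewrite -[d.+1]/`|d.+1%:Z|%N -!abszM; congr absz; apply: (@intr_inj rat).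
by rewrite !intrM numqE {1}/mkrat intrB mulrAC divfK.
Qed.

(** Cross-multiplication with the reduced fraction, whose parts are coprime. The reduced denominator
    becomes the least positive [m] with this divisibility, so no gcd has to be programmed. *)
Lemma dvdn_rat_den p n d m :
  (d.+1 %| `|p%:Z - n%:Z| * m)%N = (rat_den (mkrat p n d) %| m)%N.
Proof.
set r := mkrat p n d; have E := numq_mkrat p n d; rewrite -/r in E.
have cop : coprime (rat_den r) `|numq r| by rewrite coprime_sym coprime_num_den.
rewrite -(Gauss_dvdr m cop) -[in RHS](dvdn_pmul2r (ltn0Sn d)) [in RHS]mulnAC E.
by rewrite mulnAC [(rat_den r * _)%N]mulnC dvdn_pmul2r ?rat_den_gt0.
Qed.

Lemma mkrat_ge0 p n d : (0 <= mkrat p n d) = (n <= p)%N.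
Proof. by rewrite /mkrat pmulr_lge0 ?invr_gt0 ?ltr0Sn // subr_ge0 ler_nat. Qed.

(** [encode_rat] stores the reduced numerator and denominator, so fractions must be reduced. This is
    done once here; the field operations below only supply unreduced fractions. *)
Lemma computable_mkrat X (cX : context X) (p n d : X -> nat) :
  computable p -> computable n -> computable d ->
  computable (fun x => mkrat (p x) (n x) (d x)).
Proof.
move=> cp cn cd; pose A x := `|(p x)%:Z - (n x)%:Z|%N.
pose r x := mkrat (p x) (n x) (d x).
have cA : computable A.
  (* Of the two truncated differences at least one is 0, so their sum is the distance. *)
  have := computable_addn (computable_subn cp cn) (computable_subn cn cp).
  apply: computable_ext => x; rewrite /A; case: (leqP (n x) (p x)) => [|/ltnW] le.
    by rewrite distnEl // [X in (_ + X)%N](eqP le) addn0.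
  by rewrite distnEr // [X in (X + _)%N](eqP le).
have cden : computable (fun x => rat_den (r x)).
  apply: (computable_least
    (P := fun m x => (0 < m)%N && (A x * m %/ (d x).+1 * (d x).+1 == A x * m)%N)).
  - have c1 : computable (fun q : nat * X => q.1) by apply: computable_fst; ctxmap_tac.
    have c2 : ctxmap (fun q : nat * X => q.2) by ctxmap_tac.
    have cd' := computable_succ (computable_comp cd c2).
    have cAm := computable_muln (computable_comp cA c2) c1.
    apply: computable_andb; first exact: computable_ltn (computable_const _) c1.
    apply: computable_eqn => //; apply: computable_muln => //.
    exact: computable_divn.
  - by move=> x; rewrite rat_den_gt0 divnK ?eqxx // /A dvdn_rat_den.
  - move=> x m /andP[m0 /eqP E]; apply: dvdn_leq => //.
    by rewrite /r -dvdn_rat_den -/(A x) -E dvdn_mull.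
have cabs : computable (fun x => `|numq (r x)|%N).
  have := computable_divn (computable_muln cA cden) (computable_succ cd) (fun=> isT).
  by apply: computable_ext => x; rewrite -numq_mkrat mulnK.
have c2 : computable (fun _ : X => 2%N) by exact: computable_const.
have cnum : computable (fun x => encode_int (numq (r x))).
  (* A negative numerator [-m] has code [2 * (m - 1) + 1]. *)
  have := computable_if (computable_leq cn cp) (computable_muln c2 cabs)
    (computable_succ (computable_muln c2 (computable_pred cabs))).
  apply: computable_ext => x; rewrite -(mkrat_ge0 _ _ (d x)) -/(r x) -numq_ge0.
  by case: (numq (r x)) => m; rewrite /= mul2n.
have cden2 : computable (fun x => encode_int (denq (r x))).
  have := computable_muln c2 cden; apply: computable_ext => x.
  rewrite /rat_den; have := denq_gt0 (r x).
  by case: (denq _) => // m _; rewrite /= mul2n.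
exact: (computable_code_cons cnum (computable_code_cons cden2 (computable_const [::]))).
Qed.

Section RatOps.
Context {X : Type} {cX : context X}.
Implicit Types f g : X -> rat.

Lemma computable_oppq f : computable f -> computable (fun x => - f x).
Proof.
move=> cf; have := computable_mkrat (computable_rat_neg cf) (computable_rat_pos cf)
  (computable_pred (computable_rat_den cf)).
by apply: computable_ext => x; rewrite -[f x in LHS]mkrat_rat /mkrat -mulNr opprB.
Qed.

Lemma computable_addq f g :
  computable f -> computable g -> computable (fun x => f x + g x).
Proof.
move=> cf cg.
have [pf nf df] := And3 (computable_rat_pos cf)
  (computable_rat_neg cf) (computable_rat_den cf).
have [pg ng dg] := And3 (computable_rat_pos cg)
  (computable_rat_neg cg) (computable_rat_den cg).
have := computable_mkrat
  (computable_addn (computable_muln pf dg) (computable_muln pg df))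
  (computable_addn (computable_muln nf dg) (computable_muln ng df))
  (computable_pred (computable_muln df dg)).
apply: computable_ext => x; rewrite -[f x in LHS]mkrat_rat -[g x in LHS]mkrat_rat /mkrat.
have := rat_den_gt0 (f x); have := rat_den_gt0 (g x).
case: (rat_den (f x)) => // a; case: (rat_den (g x)) => // b _ _.
rewrite prednK ?muln_gt0 // addf_div ?pnatr_eq0 // !natrD !natrM /=.
by congr (_ / _); [ring | rewrite -natrM].
Qed.

Lemma computable_mulq f g :
  computable f -> computable g -> computable (fun x => f x * g x).
Proof.
move=> cf cg.
have [pf nf df] := And3 (computable_rat_pos cf)
  (computable_rat_neg cf) (computable_rat_den cf).
have [pg ng dg] := And3 (computable_rat_pos cg)
  (computable_rat_neg cg) (computable_rat_den cg).
have := computable_mkrat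
  (computable_addn (computable_muln pf pg) (computable_muln nf ng))
  (computable_addn (computable_muln pf ng) (computable_muln nf pg))
  (computable_pred (computable_muln df dg)).
apply: computable_ext => x; rewrite -[f x in LHS]mkrat_rat -[g x in LHS]mkrat_rat /mkrat.
have := rat_den_gt0 (f x); have := rat_den_gt0 (g x).
case: (rat_den (f x)) => // a; case: (rat_den (g x)) => // b _ _.
rewrite prednK ?muln_gt0 // mulf_div !natrD !natrM /=.
by congr (_ / _); [ring | rewrite -natrM].
Qed.

(* At [f x = 0] the witness is [mkrat 0 0 0 = 0], in agreement with [0^-1 = 0]. *)
Lemma computable_invq f : computable f -> computable (fun x => (f x)^-1).
Proof.
move=> cf.
have [pf nf df] := And3 (computable_rat_pos cf)
  (computable_rat_neg cf) (computable_rat_den cf).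
have cs := computable_addn pf nf.
have := computable_mkrat (computable_muln pf df) (computable_muln nf df)
  (computable_pred (computable_muln cs cs)).
apply: computable_ext => x; rewrite -[f x in LHS]mkrat_rat /mkrat.
have := rat_den_gt0 (f x); case: (rat_den (f x)) => // a _.
rewrite /rat_pos /rat_neg; case: ifP => _; case: (`|_|%N) => [|b].
- by rewrite !subrr !mul0r invr0.
- rewrite addn0 mul0n !mulr0n !subr0 (@prednK (_ * _)) ?muln_gt0 // invf_div !natrM.
  by field; rewrite nat1r pnatr_eq0.
- by rewrite !subrr !mul0r invr0.
- rewrite add0n mul0n !mulr0n !sub0r (@prednK (_ * _)) ?muln_gt0 // invf_div !natrM.
  by field; rewrite nat1r pnatr_eq0.
Qed.

Lemma encode_rat_inj : injective encode_rat.
Proof.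
move=> r s /(can_inj CodeSeq.codeK)[en ed].
have inj : injective encode_int.
  by case=> m [] n /= E; have := congr1 odd E; have := congr1 half E;
    rewrite /= ?odd_double ?uphalf_double ?doubleK => ->.
by apply/eqP; rewrite rat_eqE (inj _ _ en) (inj _ _ ed) !eqxx.
Qed.

End RatOps.

(** * Certificates *)

Definition recurs (N : nat) (c a : nat -> rat) : Prop :=
  forall k, a (k + N)%N = \sum_(0 <= i < N) c i * a (k + i)%N.

(** Rational tolerances keep the certificates inside [rat]; density of the rationals gives the link
    to real limits. *)
Definition tends0 (a : nat -> rat) : Prop :=
  forall e, 0 < e -> exists K, forall k, (K <= k)%N -> `|a k| < e.

Lemma recurs_ext N c a b : a =1 b -> recurs N c b -> recurs N c a.
Proof. by move=> ab rb k; rewrite ab rb; apply: eq_bigr => i _; rewrite ab. Qed.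

(** From index [N] on, each term is a combination of earlier ones. With the closure properties
    below, this upgrades checks on the indices below [N] to identities at all indices. *)
Lemma recurs_eq0 N c a : recurs N c a -> (forall k, (k < N)%N -> a k = 0) ->
  forall k, a k = 0.
Proof.
move=> ra a0; elim/ltn_ind => k IH; case: (ltnP k N) => [|Nk]; first exact: a0.
rewrite -(subnK Nk) ra big_nat big1 // => i /= iN.
by rewrite IH ?mulr0 // -ltn_subRL subKn.
Qed.

Lemma recursB N c a b :
  recurs N c a -> recurs N c b -> recurs N c (fun k => a k - b k).
Proof.
by move=> ra rb k; rewrite ra rb -sumrB; apply: eq_bigr => i _; rewrite mulrBr.
Qed.

Lemma recursZ N c a x : recurs N c a -> recurs N c (fun k => x * a k).
Proof.
by move=> ra k; rewrite ra big_distrr; apply: eq_bigr => i _; rewrite /= mulrCA.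
Qed.

Lemma recurs_shift N c a m : recurs N c a -> recurs N c (fun k => a (k + m)%N).
Proof.
by move=> ra k; rewrite addnAC ra; apply: eq_bigr => i _; rewrite addnAC.
Qed.

Lemma recurs_sum N c (I : Type) (r : seq I) (P : pred I) (F : I -> nat -> rat) :
  (forall i, recurs N c (F i)) -> recurs N c (fun k => \sum_(i <- r | P i) F i k).
Proof.
move=> rF k; under eq_bigr do rewrite rF.
by rewrite exchange_big; apply: eq_bigr => i _; rewrite big_distrr.
Qed.

Lemma tends0D a b : tends0 a -> tends0 b -> tends0 (fun k => a k + b k).
Proof.
move=> ta tb e e0; have e2 : 0 < e / 2%:R by rewrite divr_gt0.
have [K HK] := ta _ e2; have [L HL] := tb _ e2.
exists (maxn K L) => k; rewrite geq_max => /andP[/HK ak /HL bk].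
apply: le_lt_trans (ler_normD _ _) _; lra.
Qed.

Lemma tends0Z a x : tends0 a -> tends0 (fun k => x * a k).
Proof.
move=> ta e e0; have x0 : 0 < `|x| + 1 by rewrite ltr_wpDl.
have [|K HK] := ta (e / (`|x| + 1)); first by rewrite divr_gt0.
exists K => k /HK; rewrite ltr_pdivlMr // => ak; rewrite normrM.
by apply: le_lt_trans ak; rewrite mulrC ler_wpM2l // lerDl.
Qed.

Lemma tends0M a b : tends0 a -> tends0 b -> tends0 (fun k => a k * b k).
Proof.
move=> ta tb e e0; have [K HK] := ta _ e0; have [L HL] := tb 1 ltr01.
exists (maxn K L) => k; rewrite geq_max => /andP[/HK ak /HL bk].
by rewrite normrM -[e]mulr1 ltr_pM.
Qed.

Lemma tends0_shift a m : tends0 a -> tends0 (fun k => a (m + k)%N).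
Proof.
move=> ta e /ta[K HK]; exists K => k Kk; apply: HK.
by rewrite (leq_trans Kk) ?leq_addl.
Qed.

Lemma tends0_norm a : tends0 a -> tends0 (fun k => `|a k|).
Proof. by move=> ta e /ta[K HK]; exists K => k /HK; rewrite normr_id. Qed.

Lemma tends0_sum (I : Type) (r : seq I) (F : I -> nat -> rat) :
  (forall i, tends0 (F i)) -> tends0 (fun k => \sum_(i <- r) F i k).
Proof.
move=> tF e e0; elim: r e e0 => [|i r IH] e e0.
  by exists 0%N => k _; rewrite big_nil normr0.
have [K HK] := tends0D (tF i) IH e0.
by exists K => k /HK; rewrite big_cons.
Qed.

Definition conv_cert (N : nat) (a : nat -> rat) (n : nat) (c : nat -> rat) : bool :=
  (\sum_(0 <= i < n) `|c i| < 1) &&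
  all (fun k => a (k + n)%N == \sum_(0 <= i < n) c i * a (k + i)%N) (iota 0 N).

Definition bilin (N : nat) (a : nat -> rat) (Y : nat -> nat -> rat) (i j : nat) : rat :=
  \sum_(0 <= p < N) \sum_(0 <= q < N) Y p q * (a (i + p)%N * a (j + q)%N).

(* The form is [B(S^i a, S^j a)], for the shift [S]; only [p, q < N] have to be
   checked because both sides are linear recurrence sequences in [p] and in [q]. *)
Definition div_cert (N : nat) (a : nat -> rat) (t : bool) (Y : nat -> nat -> rat)
    (i j : nat) : bool :=
  all (fun p => all (fun q => bilin N a Y p q - bilin N a Y p.+1 q.+1
                              == t%:R * (a p * a q)) (iota 0 N)) (iota 0 N)
  && (if t then bilin N a Y i i < 0 else bilin N a Y i j != 0).

Section Certificates.
Variables (N : nat) (c a : nat -> rat).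
Hypothesis ra : recurs N c a.

(** The defect of the new recurrence obeys the old one of order [N], so it vanishes as soon as it
    does for [k < N]. *)
Lemma conv_certP n u : conv_cert N a n u -> recurs n u a.
Proof.
case/andP=> _ /allP H k; apply/eqP; rewrite -subr_eq0; apply/eqP; move: k.
apply: (@recurs_eq0 N c) => [|k kN].
  apply: recursB; first exact: recurs_shift.
  by apply: recurs_sum => i; apply: recursZ; apply: recurs_shift.
by apply/eqP; rewrite subr_eq0; apply: H; rewrite mem_iota.
Qed.

Lemma recurs_bilinl Y j : recurs N c (fun i => bilin N a Y i j).
Proof.
apply: recurs_sum => p; apply: recurs_sum => q.
apply: recurs_ext (recursZ (Y p q * a (j + q)%N) (recurs_shift p ra)) => k /=; ring.
Qed.

Lemma recurs_bilinr Y i : recurs N c (fun j => bilin N a Y i j).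
Proof.
apply: recurs_sum => p; apply: recurs_sum => q.
apply: recurs_ext (recursZ (Y p q * a (i + p)%N) (recurs_shift q ra)) => k /=; ring.
Qed.

(** The defect is a recurrence sequence in [i] for fixed [j] and in [j] for fixed [i]; [recurs_eq0]
    applies once in each variable. *)
Lemma stein_extend Y t :
  (forall p q, (p < N)%N -> (q < N)%N ->
     bilin N a Y p q - bilin N a Y p.+1 q.+1 = t * (a p * a q)) ->
  forall i j, bilin N a Y i j - bilin N a Y i.+1 j.+1 = t * (a i * a j).
Proof.
move=> H i j; apply/eqP; rewrite -subr_eq0; apply/eqP; move: i.
have rB (b : nat -> rat) : recurs N c b -> recurs N c (fun i => b i.+1).
  by move/(recurs_shift 1); apply: recurs_ext => i; rewrite addn1.
apply: (@recurs_eq0 N c) => [|i iN].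
  apply: recursB; first apply: recursB.
  - exact: recurs_bilinl.
  - exact: (rB (fun i => bilin N a Y i j.+1) (recurs_bilinl Y j.+1)).
  - by apply: recurs_ext (recursZ (t * a j) ra) => k; ring.
move: j; apply: (@recurs_eq0 N c) => [|j jN].
  apply: recursB; first apply: recursB.
  - exact: recurs_bilinr.
  - exact: (rB (fun j => bilin N a Y i.+1 j) (recurs_bilinr Y i.+1)).
  - by apply: recurs_ext (recursZ (t * a i) ra) => k; ring.
by rewrite H // subrr.
Qed.

Lemma tends0_bilin Y i j : tends0 a -> tends0 (fun k => bilin N a Y (i + k) (j + k)).
Proof.
move=> ta; apply: tends0_sum => p; apply: tends0_sum => q.
apply: tends0Z; apply: tends0M => e /(tends0_shift _ ta).
  by case/(_ (i + p)%N) => K HK; exists K => k /HK; rewrite addnAC.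
by case/(_ (j + q)%N) => K HK; exists K => k /HK; rewrite addnAC.
Qed.

(** With [t] true the form never increases along [(i + K, i + K)], so it stays below a negative
    value; with [t] false it is constant and nonzero along [(i + K, j + K)]. If [a] tended to 0, so
    would both. *)
Lemma div_cert_sound t Y i j : div_cert N a t Y i j -> ~ tends0 a.
Proof.
case/andP=> /allP H Hij ta.
have stein p q : bilin N a Y p q - bilin N a Y p.+1 q.+1 = t%:R * (a p * a q).
  apply: stein_extend => {p q} p q pN qN.
  by apply/eqP; apply: (allP (H p _)); rewrite mem_iota.
case: t Hij {H} stein => /= Hij stein.
  have [K /(_ K (leqnn K))] := tends0_bilin Y i i ta
    (e := - bilin N a Y i i) ltac:(by rewrite oppr_gt0).
  have : bilin N a Y (i + K) (i + K) <= bilin N a Y i i.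
    elim: K => [|K IH]; first by rewrite addn0.
    apply: le_trans IH; rewrite addnS -subr_ge0 stein mul1r; exact: sqr_ge0.
  move=> le; rewrite ltNge => /negP; apply.
  by rewrite ler0_norm ?lerN2 // (le_trans le) // ltW.
have [K /(_ K (leqnn K))] := tends0_bilin Y i j ta
  (e := `|bilin N a Y i j|) ltac:(by rewrite normr_gt0).
suff -> : bilin N a Y (i + K) (j + K) = bilin N a Y i j by rewrite ltxx.
elim: K => [|K <-]; first by rewrite !addn0.
by apply/esym/eqP; rewrite !addnS -subr_eq0 stein mul0r.
Qed.

(** * Hankel matrices and existence of certificates *)

Definition hrow n : 'rV[rat]_N := \row_(p < N) a (n + p)%N.
Definition hankel : 'M[rat]_N := \matrix_(i < N, p < N) a (i + p)%N.

(** The recurrence writes a row of index at least [N] through the [N] preceding rows, so the first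
    [N] rows span all of them. *)
Lemma hrow_sub n : (hrow n <= hankel)%MS.
Proof.
elim/ltn_ind: n => n IH; case: (ltnP n N) => [nN|Nn].
  have -> : hrow n = row (Ordinal nN) hankel by apply/rowP => p; rewrite !mxE.
  exact: row_sub.
have -> : hrow n = \sum_(i < N) c i *: hrow (n - N + i).
  apply/rowP => p; rewrite summxE !mxE -{1}(subnK Nn) addnAC ra big_mkord.
  by apply: eq_bigr => i _; rewrite !mxE addnAC.
apply: summx_sub => i _; apply: scalemx_sub; apply: IH.
by rewrite -ltn_subRL subKn.
Qed.

Definition extend0 (v : 'rV[rat]_N) (i : nat) : rat :=
  if insub i is Some j then v 0 j else 0.

Lemma extend0_ord v (i : 'I_N) : extend0 v i = v 0 i.
Proof. by rewrite /extend0 valK. Qed.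

Lemma sum_extend0 v n (F : rat -> nat -> rat) :
  (N <= n)%N -> (forall i, F 0 i = 0) ->
  \sum_(0 <= i < n) F (extend0 v i) i = \sum_(i < N) F (v 0 i) i.
Proof.
move=> Nn F0; rewrite (big_cat_nat (leq0n N) Nn) /= [X in _ + X](_ : _ = 0) ?addr0.
  by rewrite big_mkord; apply: eq_bigr => i _; rewrite extend0_ord.
rewrite big_nat big1 // => i /andP[Ni _].
by rewrite /extend0 insubF // ltnNge Ni.
Qed.

(** [u n] expresses row [n] through the first [N] rows, which is a recurrence of order [n]. Its
    entries are fixed combinations of [a n, ..., a (n + N - 1)], so they tend to 0 with [a] and
    their absolute sum drops below 1. *)
Lemma conv_cert_complete : tends0 a -> exists n u, conv_cert N a n u.
Proof.
move=> ta; pose u n := hrow n *m pinvmx hankel.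
have tu : tends0 (fun n => \sum_(i <- enum 'I_N) `|u n 0 i|).
  apply: tends0_sum => i; apply: tends0_norm => e e0.
  have ts : tends0 (fun n => \sum_(p <- enum 'I_N) pinvmx hankel p i * a (p + n)%N).
    by apply: tends0_sum => p; apply: tends0Z; apply: tends0_shift.
  have [K HK] := ts _ e0; exists K => k /HK.
  suff -> : u k 0 i = \sum_(p <- enum 'I_N) pinvmx hankel p i * a (p + k)%N by [].
  by rewrite mxE big_enum /=; apply: eq_bigr => p _; rewrite mxE mulrC addnC.
(* An order of at least [N] makes room for all [N] coefficients; those from [N] on are 0. *)
have [K HK] := tu 1 ltr01; pose n := (N + K)%N.
exists n, (extend0 (u n)); apply/andP; split.
  rewrite (sum_extend0 _ (F := fun x _ => `|x|)) ?leq_addr //.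
  have := HK n (leq_addl _ _); rewrite big_enum /= ger0_norm //; exact: sumr_ge0.
apply/allP => k; rewrite mem_iota add0n => kN.
rewrite (sum_extend0 _ (F := fun x i => x * a (k + i)%N)) ?leq_addr //; last first.
  by move=> i; rewrite mul0r.
have /rowP/(_ (Ordinal kN)) := mulmxKpV (hrow_sub n).
rewrite !mxE /= [(n + k)%N]addnC => <-; apply/eqP; apply: eq_bigr => i _.
by rewrite !mxE addnC.
Qed.

Definition shifted_hankel : 'M[rat]_N := \matrix_(i < N, p < N) a (i.+1 + p)%N.

Lemma tr_hankel : hankel^T = hankel.
Proof. by apply/matrixP => i j; rewrite !mxE addnC. Qed.

Lemma tr_shifted_hankel : shifted_hankel^T = shifted_hankel.
Proof. by apply/matrixP => i j; rewrite !mxE addSnnS addnC. Qed.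

(** A matrix of the shift on the spanning rows; the pseudo-inverse allows for a singular
    [hankel]. *)
Definition companion : 'M[rat]_N := shifted_hankel *m pinvmx hankel.

Lemma mul_companion_hankel : companion *m hankel = shifted_hankel.
Proof.
apply: mulmxKpV; apply/row_subP => i.
suff -> : row i shifted_hankel = hrow i.+1 by exact: hrow_sub.
by apply/rowP => p; rewrite !mxE.
Qed.

Definition nat_mx (Y : 'M[rat]_N) (p q : nat) : rat :=
  if insub p is Some i then if insub q is Some j then Y i j else 0 else 0.

(** Covers both Gram matrices: [G] is [hankel] for [f] the identity and [shifted_hankel] for [f] the
    successor. *)
Lemma bilin_mx Y (G : 'M[rat]_N) (f : 'I_N -> nat) i j :
  (forall i p, G i p = a (f i + p)%N) ->
  bilin N a (nat_mx Y) (f i) (f j) = (G *m Y *m G^T) i j.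
Proof.
move=> GE; rewrite /bilin big_mkord mxE.
under [RHS]eq_bigr => q _ do rewrite !mxE mulr_suml.
rewrite [RHS]exchange_big /=; apply: eq_bigr => p _.
rewrite big_mkord; apply: eq_bigr => q _.
by rewrite /nat_mx !valK !GE mulrCA mulrA.
Qed.

Lemma bilin_hankel Y (i j : 'I_N) :
  bilin N a (nat_mx Y) i j = (hankel *m Y *m hankel) i j.
Proof.
rewrite -[X in _ *m X]tr_hankel -(bilin_mx Y (f := @nat_of_ord N)) //.
by move=> ? ?; rewrite mxE.
Qed.

Lemma bilin_shifted_hankel Y (i j : 'I_N) :
  bilin N a (nat_mx Y) i.+1 j.+1 = (shifted_hankel *m Y *m shifted_hankel) i j.
Proof.
rewrite -[X in _ *m X]tr_shifted_hankel -(bilin_mx Y (f := fun i => i.+1)) //.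
by move=> ? ?; rewrite mxE.
Qed.

(** Otherwise infinitely many terms are at least some [e] in absolute value, and more than
    [B / e ^ 2] of them overshoot [B]. *)
Lemma square_summable_tends0 B :
  (forall K, \sum_(0 <= k < K) a k ^+ 2 <= B) -> tends0 a.
Proof.
move=> sB; apply: contrapT => nt.
have [e e0 He] : exists2 e, 0 < e & forall K, exists2 k, (K <= k)%N & e <= `|a k|.
  apply: contrapT => H; apply: nt => e e0; apply: contrapT => H'.
  apply: H; exists e => // K; apply: contrapT => H''; apply: H'.
  exists K => k Kk; rewrite ltNge; apply/negP => ek; apply: H''; by exists k.
have big_sum n : exists K, n%:R * e ^+ 2 <= \sum_(0 <= k < K) a k ^+ 2.
  elim: n => [|n [K HK]]; first by exists 0%N; rewrite mul0r big_nil.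
  have [k Kk ek] := He K; exists k.+1; rewrite big_nat_recr //= -natr1 mulrDl mul1r.
  apply: lerD; last by rewrite -[a k ^+ 2]real_normK ?num_real // lerXn2r ?nnegrE // ltW.
  apply: le_trans HK _; rewrite (big_cat_nat (leq0n K) Kk) /= lerDl.
  by apply: sumr_ge0 => i _; exact: sqr_ge0.
have [K HK] := big_sum (Num.truncn (B / e ^+ 2)).+1.
have := le_trans HK (sB K); rewrite leNgt => /negP; apply.
by rewrite -ltr_pdivrMr ?exprn_gt0 // truncnS_gt.
Qed.

(* The Stein operator [Z |-> Z - C Z C^T] preserves the Gram matrices of the
   bilinear forms on the span of the shifts of [a]. If it has a kernel there,
   that yields a certificate with [t = false]; otherwise it is onto and the
   form [Y] with [Y(f, f) - Y(Sf, Sf) = f_0 ^ 2] exists. Were it nonnegative,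
   [a] would be square summable. *)
Lemma div_cert_complete : ~ tends0 a -> exists t Y i j, div_cert N a t Y i j.
Proof.
move=> nta; set H := hankel; set C := companion.
pose W := limg (linfun (mulmxr H \o mulmx H : 'M[rat]_N -> 'M[rat]_N)).
pose L := linfun (idfun \- (mulmxr C^T \o mulmx C) : 'M[rat]_N -> 'M[rat]_N).
have inW Y : H *m Y *m H \in W.
  by rewrite -[H *m Y *m H](lfunE (mulmxr H \o mulmx H)) memv_img ?memvf.
have Wex Z : Z \in W -> exists Y, Z = H *m Y *m H.
  by case/memv_imgP => Y _ ->; exists Y; rewrite lfunE.
have CH : C *m H = shifted_hankel by exact: mul_companion_hankel.
have HC : H *m C^T = shifted_hankel.
  by rewrite -[H]tr_hankel -trmx_mul CH tr_shifted_hankel.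
(* [C H] and [H C^T] both equal the shifted Hankel matrix, so [L] turns the Gram matrix of [B] into
   that of [B(f, g) - B(Sf, Sg)]. *)
have LE Y : L (H *m Y *m H) = H *m Y *m H - shifted_hankel *m Y *m shifted_hankel.
  by rewrite lfunE /= -{1}CH -HC !mulmxA.
have LW : (L @: W <= W)%VS.
  apply/subvP => _ /memv_imgP[_ /Wex[Y ->] ->]; rewrite LE memvB //.
  by rewrite -{1}HC -CH mulmxA -(mulmxA H) -(mulmxA H) inW.
have certE Y (t : bool) (T : 'M[rat]_N) : L (H *m Y *m H) = T ->
    (forall p q : 'I_N, T p q = t%:R * (a p * a q)) ->
    all (fun p => all (fun q => bilin N a (nat_mx Y) p q - bilin N a (nat_mx Y) p.+1 q.+1
                              == t%:R * (a p * a q)) (iota 0 N)) (iota 0 N).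
  move=> LT TE; apply/allP => p; rewrite mem_iota add0n => pN.
  apply/allP => q; rewrite mem_iota add0n => qN.
  have := TE (Ordinal pN) (Ordinal qN); rewrite -LT LE mxE [X in _ + X]mxE.
  by rewrite -bilin_hankel -bilin_shifted_hankel /= => ->.
have [K0|] := eqVneq (W :&: lker L)%VS 0%VS; last first.
  rewrite -vpick0; set Z := vpick _ => Z0.
  have : Z \in (W :&: lker L)%VS by exact: memv_pick.
  rewrite memv_cap memv_ker => /andP[/Wex[Y ZE] /eqP LZ].
  have [i [j Zij]] : exists i j, Z i j != 0.
    apply: contrapT => nij; case/negP: Z0; apply/eqP/matrixP => i j; rewrite mxE.
    by apply/eqP; apply: contrapT => /negP ij; apply: nij; exists i, j.
  exists false, (nat_mx Y), i, j; apply/andP; split; last by rewrite bilin_hankel -ZE.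
  by apply: (certE _ _ 0); rewrite -?ZE // => p q; rewrite mxE mul0r.
(* An injective endomorphism of the finite-dimensional [W] is onto. *)
have LWE : (L @: W)%VS = W.
  by apply/eqP; rewrite eqEdim LW limg_dim_eq ?leqnn.
pose h : 'cV[rat]_N := \col_p a p.
(* [h] is the first column of [H], so [h h^T = H (e e^T) H] lies in [W] and is attained by [L]. *)
pose e : 'cV[rat]_N := \col_p (val p == 0%N)%:R.
have HE : H *m e = h.
  apply/colP => p; rewrite !mxE (bigD1 (Ordinal (leq_ltn_trans (leq0n p) (ltn_ord p)))) //=.
  rewrite !mxE addn0 mulr1 big1 ?addr0 // => q /negPf q0.
  by rewrite !mxE -val_eqE /= in q0 *; rewrite q0 mulr0.
have : h *m h^T \in (L @: W)%VS.
  by rewrite LWE -HE trmx_mul tr_hankel mulmxA -(mulmxA H) inW.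
case/memv_imgP => Z /Wex[Y ->] LY.
have {certE} cert := certE Y true _ (esym LY) _.
have TE (p q : 'I_N) : (h *m h^T) p q = true%:R * (a p * a q).
  by rewrite mxE big_ord1 !mxE mul1r.
have [[K BK]|B_ge0] := pselect (exists K, bilin N a (nat_mx Y) K K < 0).
  by exists true, (nat_mx Y), K, K; rewrite /div_cert BK cert.
case: nta; apply: (@square_summable_tends0 (bilin N a (nat_mx Y) 0 0)) => K.
have stein : forall i j, bilin N a (nat_mx Y) i j - bilin N a (nat_mx Y) i.+1 j.+1
    = true%:R * (a i * a j).
  apply: stein_extend => p q pN qN.
  by apply/eqP; apply: (allP (allP (cert TE) p _)); rewrite mem_iota.
(* The sum telescopes along the diagonal, and the subtracted last value is nonnegative by
   [B_ge0]. *)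
suff -> : \sum_(0 <= k < K) a k ^+ 2 = bilin N a (nat_mx Y) 0 0 - bilin N a (nat_mx Y) K K.
  by rewrite gerBl leNgt; apply/negP => BK; apply: B_ge0; exists K.
elim: K => [|K IH]; first by rewrite big_nil subrr.
by rewrite big_nat_recr //= IH expr2 -[a K * a K]mul1r -(stein K K) addrA subrK.
Qed.

End Certificates.

(** * Values of convergent series *)

Lemma sum_shift (f : nat -> rat) m K :
  \sum_(0 <= k < K) f (k + m)%N
  = \sum_(0 <= k < K + m) f k - \sum_(0 <= k < m) f k.
Proof.
rewrite [in RHS](big_cat_nat (leq0n m) (leq_addl K m)) /= addrAC subrr add0r.
by rewrite -{2}[m]add0n big_addn addnK.
Qed.

(** Summing the recurrence over [k < K] gives [T (K + n) - T n <= th * T (K + n)], which bounds the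
    partial sums of [|e k|], hence also those of the squares. *)
Lemma contraction_tends0 n c (e : nat -> rat) :
  recurs n c e -> \sum_(0 <= i < n) `|c i| < 1 -> tends0 e.
Proof.
move=> re th1; set th := \sum_(0 <= i < n) `|c i| in th1.
pose T K := \sum_(0 <= k < K) `|e k|.
have T_mono K m : (K <= m)%N -> T K <= T m.
  by move=> Km; rewrite /T (big_cat_nat (leq0n K) Km) /= lerDl sumr_ge0.
have T_bound K : T K <= T n / (1 - th).
  rewrite ler_pdivlMr ?subr_gt0 // mulrBr mulr1 lerBlDr.
  (* As [th < 1], [x * (1 - th)] grows with [x], so [T K] may be replaced by [T (K + n)]. *)
  apply: (@le_trans _ _ (T (K + n)%N - T (K + n)%N * th + T K * th)); last first.
    rewrite lerD2r lerBlDr.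
    rewrite [leLHS](_ : _ = T n + \sum_(0 <= k < K) `|e (k + n)%N|); last first.
      by rewrite (sum_shift (fun k => `|e k|)) addrC subrK.
    rewrite lerD2l.
    apply: (@le_trans _ _ (\sum_(0 <= k < K) \sum_(0 <= i < n) `|c i| * `|e (k + i)%N|)).
      apply: ler_sum => k _; rewrite re; apply: le_trans (ler_norm_sum _ _ _) _.
      by apply: ler_sum => i _; rewrite normrM.
    rewrite exchange_big /= mulrC /th mulr_suml big_nat [leRHS]big_nat.
    apply: ler_sum => i /= iN; rewrite -mulr_sumr ler_wpM2l //.
    rewrite (sum_shift (fun k => `|e k|)) lerBlDr.
    apply: ler_wpDr; first exact: sumr_ge0.
    by apply: T_mono; rewrite leq_add2l ltnW.
  have := T_mono _ _ (leq_addr n K).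
  move: th1; rewrite -subr_gt0 => th1 TT.
  have : 0 <= (T (K + n)%N - T K) * (1 - th)
    by apply: mulr_ge0; [rewrite subr_ge0 | exact: ltW].
  lra.
(* Each [|e k|] is at most [B], so the squares sum to at most [B] times the sum of the [|e k|],
   hence at most [B ^ 2]. *)
apply: (@square_summable_tends0 _ ((T n / (1 - th)) ^+ 2)) => K.
set B := T n / _ in T_bound *.
have e_le k : `|e k| <= B.
  by apply: le_trans (T_bound k.+1); rewrite /T big_nat_recr //= lerDr sumr_ge0.
have B0 : 0 <= B by apply: le_trans (e_le 0%N).
apply: (@le_trans _ _ (\sum_(0 <= k < K) B * `|e k|)).
  apply: ler_sum => k _.
  by rewrite -[e k ^+ 2]real_normK ?num_real // expr2 ler_wpM2r.
by rewrite -mulr_sumr expr2; apply: ler_wpM2l => //; exact: T_bound.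
Qed.

(** The solution [v] of [v - (a_0 + ... + a_(n-1)) = \sum_i c_i (v - (a_0 + ... + a_(i-1)))], which
    is the recurrence summed over all [k]. *)
Definition cert_sum (a : nat -> rat) (n : nat) (c : nat -> rat) : rat :=
  (\sum_(0 <= k < n) a k - \sum_(0 <= i < n) c i * \sum_(0 <= k < i) a k)
  / (1 - \sum_(0 <= i < n) c i).

(** Lets [contraction_tends0] act on the errors of the partial sums. The denominator of [cert_sum]
    is positive because [\sum_i c_i <= \sum_i |c_i| < 1]. *)
Lemma recurs_partial_sum a n c :
  recurs n c a -> \sum_(0 <= i < n) `|c i| < 1 ->
  recurs n c (fun K => \sum_(0 <= k < K) a k - cert_sum a n c).
Proof.
move=> ra c1 K /=; set v := cert_sum a n c.
have cn1 : 1 - \sum_(0 <= i < n) c i != 0.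
  rewrite gt_eqF // subr_gt0; apply: le_lt_trans c1.
  by apply: ler_sum => i _; exact: ler_norm.
have vE : v - v * \sum_(0 <= i < n) c i
    = \sum_(0 <= k < n) a k - \sum_(0 <= i < n) c i * \sum_(0 <= k < i) a k.
  by rewrite -[X in X - _]mulr1 -mulrBr divfK.
have SE : \sum_(0 <= k < K + n) a k - \sum_(0 <= k < n) a k
    = \sum_(0 <= i < n) c i * \sum_(0 <= k < K + i) a k
      - \sum_(0 <= i < n) c i * \sum_(0 <= k < i) a k.
  rewrite -sum_shift; under eq_bigr do rewrite ra.
  rewrite exchange_big -sumrB; apply: eq_bigr => i _ /=.
  by rewrite -mulr_sumr sum_shift mulrBr.
under [RHS]eq_bigr do rewrite mulrBr; rewrite sumrB -mulr_suml.
lra.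
Qed.

Section Real.
Local Open Scope classical_set_scope.
Variable R : realType.
Local Notation ratr := (ratr : rat -> R).

Lemma tends0_cvg (s : nat -> rat) v :
  tends0 (fun k => s k - v) -> (fun k => ratr (s k)) @ \oo --> ratr v.
Proof.
move=> ts; apply/cvgrPdist_lt => e e0.
have [q] := rat_in_itvoo e0; rewrite in_itv /= ltr0q => /andP[q0 qe].
have [K HK] := ts _ q0; exists K => //= k Kk.
apply: lt_trans qe; rewrite distrC -rmorphB -ratr_norm ltr_rat; exact: HK.
Qed.

Lemma cvg_series_tends0 (a : nat -> rat) :
  cvgn (series (fun k => ratr (a k))) -> tends0 a.
Proof.
move/cvg_series_cvg_0/cvgrPdist_lt => H e e0.
have [|K _ HK] := H (ratr e); first by rewrite ltr0q.
exists K => k /HK; by rewrite /= sub0r normrN -ratr_norm ltr_rat.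
Qed.

Lemma conv_cert_cvg N c0 a n c : recurs N c0 a -> conv_cert N a n c ->
  series (fun k => ratr (a k)) @ \oo --> ratr (cert_sum a n c).
Proof.
move=> ra cert; have c1 : \sum_(0 <= i < n) `|c i| < 1 by case/andP: cert.
have := contraction_tends0 (recurs_partial_sum (conv_certP ra cert) c1) c1.
move/tends0_cvg; apply: cvg_trans.
by rewrite (_ : series _ = fun K => ratr (\sum_(0 <= k < K) a k)) //; apply/funext => K;
  rewrite /series /= rmorph_sum.
Qed.

End Real.

(** * Rewards as linear recurrence sequences *)

(** Cayley-Hamilton: the monic characteristic polynomial annihilates [A], which gives one recurrence
    for all coordinates. *)
Lemma matrix_recurs n (A : 'M[rat]_n) (v : nat -> 'cV[rat]_n) :
  (forall k, v k.+1 = A *m v k) ->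
  exists c, forall i, recurs n c (fun k => v k i 0).
Proof.
case: n A v => [|n] A v vS; first by exists (fun=> 0) => -[].
exists (fun j => - (char_poly A)`_j) => i k; rewrite big_mkord.
have vD m : v (k + m)%N = A ^+ m *m v k.
  elim: m => [|m IH]; first by rewrite addn0 expr0 mul1mx.
  by rewrite addnS vS IH exprS mulmxA.
have := Cayley_Hamilton A; rewrite -{1}[char_poly A]coefK poly_def.
rewrite rmorph_sum size_char_poly big_ord_recr /=.
have /monicP := char_poly_monic A; rewrite lead_coefE size_char_poly /= => ->.
rewrite scale1r rmorphXn /= horner_mx_X => /(congr1 (fun B => (B *m v k) i 0)).
rewrite mul0mx mulmxDl -vD mxE [in X in _ = X]mxE mulmx_suml summxE => /eqP.
rewrite addrC addr_eq0 => /eqP ->; rewrite -sumrN; apply: eq_bigr => j _.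
by rewrite horner_mxZ rmorphXn /= horner_mx_X -scalemxAl -vD mxE mulNr.
Qed.

Lemma linear_recurs (T : finType) (A : T -> T -> rat) (F : T -> nat -> rat) :
  (forall t k, F t k.+1 = \sum_s A t s * F s k) ->
  exists c, forall t, recurs #|T| c (F t).
Proof.
move=> FS; pose v k : 'cV[rat]_#|T| := \col_i F (enum_val i) k.
have [|c Hc] := @matrix_recurs _ (\matrix_(i, j) A (enum_val i) (enum_val j)) v.
  move=> k; apply/colP => i; rewrite !mxE FS (reindex _ (onW_bij _ (enum_val_bij T))).
  by apply: eq_bigr => j _; rewrite !mxE.
exists c => t; apply: recurs_ext (Hc (enum_rank t)) => k.
by rewrite mxE enum_rankK.
Qed.

(** Multiplying the recurrence by [x ^ (k + N)] leaves the factor [x ^ (N - i)] on the term of index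
    [k + i]. *)
Lemma recurs_geom N c a x : recurs N c a ->
  recurs N (fun i => x ^+ (N - i) * c i) (fun k => x ^+ k * a k).
Proof.
move=> ra k; rewrite ra big_distrr big_nat [RHS]big_nat; apply: eq_bigr => i /= iN.
by rewrite -{1}(subnK (ltnW iN)) addnCA !exprD; ring.
Qed.

(** Each entry [n] costs a factor [2 ^ n > n]. Hence the code of a weight bounds the degrees of its
    monomials. *)
Lemma leq_sumn_code s : (sumn s <= CodeSeq.code s)%N.
Proof.
elim: s => // n s IH; rewrite [sumn _]/=.
apply: leq_trans (_ : (2 ^ n + CodeSeq.code s <= _)%N).
  by rewrite leq_add // ltnW // ltn_expl.
rewrite -[CodeSeq.code (n :: s)]/(2 ^ n * (CodeSeq.code s).*2.+1)%N mulnS leq_add2l.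
by rewrite -addnn mulnDr (leq_trans _ (leq_addr _ _)) // leq_pmull // expn_gt0.
Qed.

Lemma leq_mem_sumn n s : n \in s -> (n <= sumn s)%N.
Proof.
elim: s => //= m s IH; rewrite inE => /predU1P[->|/IH le]; first exact: leq_addr.
exact: leq_trans le (leq_addl _ _).
Qed.

Section Reward.
Variables (d : nat) (M : 'M[rat]_d) (q : 'cV[rat]_d).

Definition orbit_coord (k : nat) (i : 'I_d) : rat := (M ^+ k *m q) i 0.

Lemma orbit_coordS k i : orbit_coord k.+1 i = \sum_j M i j * orbit_coord k j.
Proof. by rewrite /orbit_coord exprS -mulmxA mxE. Qed.

Definition rat_reward (ts : terms d) (k : nat) : rat :=
  \sum_(t <- ts) t.1 * \prod_(i < d) orbit_coord k i ^+ tnth t.2 i.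

Lemma reward_ratr (R : realType) ts k :
  reward R M q (poly_of_terms ts) k = ratr (rat_reward ts k).
Proof.
rewrite /reward /weight /poly_of_terms raddf_sum /rat_reward rmorph_sum.
apply: eq_bigr => t _ /=; rewrite mmapZ mmapX rmorphM /mmap1 rmorph_prod.
congr (_ * _); apply: eq_bigr => i _; rewrite rmorphXn /=; congr (_ ^+ _).
rewrite /orbit_coord.
have <- : map_mx (ratr : rat -> R) (M ^+ k) = map_mx (ratr : rat -> R) M ^+ k.
  elim: k => [|k IH]; first by rewrite !expr0 map_mx1.
  by rewrite !exprS map_mxM IH.
by rewrite -map_mxM mxE.
Qed.

(* Homogenizing with an extra constant coordinate [None], every monomial of
   degree at most [D] is a product of exactly [D] coordinates. *)
Lemma rat_reward_recurs ts :
  exists c, recurs (d.+1 ^ encode_terms ts) c (rat_reward ts).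
Proof.
set D := encode_terms ts.
pose y k (o : option 'I_d) := oapp (orbit_coord k) 1 o.
pose A (o o' : option 'I_d) : rat :=
  match o, o' with
  | Some i, Some j => M i j | None, None => 1 | _, _ => 0
  end.
have yS k o : y k.+1 o = \sum_o' A o o' * y k o'.
  rewrite (bigD1 None) //= (reindex_omap Some id) => [|[]] //=.
  case: o => [i|] /=; last first.
    by rewrite mul1r big1 ?addr0 // => j _; rewrite mul0r.
  rewrite mul0r add0r orbit_coordS; apply: eq_big => j; by rewrite ?eqxx.
(* Products of [D] coordinates evolve linearly, under the [D]-th tensor power of [A]. *)
pose F (f : {ffun 'I_D -> option 'I_d}) k := \prod_j y k (f j).
have [|c Hc] := @linear_recurs _ (fun f g : {ffun 'I_D -> option 'I_d} =>
    \prod_j A (f j) (g j)) F.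
  move=> f k; rewrite /F; under eq_bigr do rewrite yS.
  by rewrite bigA_distr_bigA; apply: eq_bigr => g _; rewrite big_split.
have monom t : t \in ts -> exists f, forall k,
    \prod_(i < d) orbit_coord k i ^+ tnth t.2 i = F f k.
  (* [s] repeats each coordinate as often as its exponent says; positions beyond its end read as
     [None], the constant coordinate 1. *)
  move=> tts; pose s := flatten [seq nseq (tnth t.2 i) i | i <- enum 'I_d].
  have sD : (size s <= D)%N.
    have -> : size s = sumn t.2.
      rewrite size_flatten /shape -map_comp -[in RHS](map_tnth_enum t.2).
      by congr sumn; apply: eq_map => i; rewrite /= size_nseq.
    apply: leq_trans (leq_sumn_code _) _.
    apply: leq_trans (_ : CodeSeq.code [:: encode_rat t.1; CodeSeq.code t.2] <= _)%N.
      apply: leq_trans (leq_sumn_code _); apply: leq_mem_sumn.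
      by rewrite !inE eqxx orbT.
    apply: leq_trans (leq_sumn_code _); apply: leq_mem_sumn.
    by apply/mapP; exists t.
  exists [ffun j : 'I_D => onth s j] => k.
  transitivity (\prod_(i <- s) orbit_coord k i).
    rewrite big_flatten big_map big_enum /=; apply: eq_bigr => i _.
    by rewrite big_nseq iter_mulr mulr1.
  rewrite /F; under [RHS]eq_bigr do rewrite ffunE.
  rewrite -(big_mkord xpredT (fun j => y k (onth s j))) (big_cat_nat (leq0n _) sD) /=.
  rewrite [X in _ * X]big_nat [X in _ * X]big1 ?mulr1 => [|j /andP[sj _]]; last first.
    by rewrite onth_default.
  case: (s) => [|i0 s']; first by rewrite !big_nil.
  rewrite (big_nth i0) big_nat [RHS]big_nat; apply: eq_bigr => j /= js.
  by rewrite onthE (nth_map i0).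
exists c; have -> : (d.+1 ^ D = #|{ffun 'I_D -> option 'I_d}|)%N.
  by rewrite card_ffun card_option !card_ord.
apply: (@recurs_ext _ _ _
  (fun k => \sum_(i < size ts) rat_reward [:: tnth (in_tuple ts) i] k)).
  by move=> k; rewrite /rat_reward big_tnth; apply: eq_bigr => i _; rewrite big_seq1.
apply: recurs_sum => i; have [f Hf] := monom _ (mem_tnth i (in_tuple ts)).
apply: recurs_ext (recursZ (tnth (in_tuple ts) i).1 (Hc f)) => k.
by rewrite /rat_reward big_seq1 Hf.
Qed.

End Reward.

(** * The decision procedure *)

Lemma computable_sumq X (cX : context X) (F : nat -> X -> rat) (n : X -> nat) :
  computable (fun p : nat * X => F p.1 p.2) -> computable n ->
  computable (fun x => \sum_(0 <= i < n x) F i x).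
Proof. by apply: computable_big => Y cY f g; apply: computable_addq. Qed.

Lemma computable_prodq X (cX : context X) (F : nat -> X -> rat) (n : X -> nat) :
  computable (fun p : nat * X => F p.1 p.2) -> computable n ->
  computable (fun x => \prod_(0 <= i < n x) F i x).
Proof. by apply: computable_big => Y cY f g; apply: computable_mulq. Qed.

Lemma computable_expq X (cX : context X) (f : X -> rat) (n : X -> nat) :
  computable f -> computable n -> computable (fun x => f x ^+ n x).
Proof.
move=> cf cn; have := @computable_prodq _ _ (fun _ x => f x) n _ cn.
move=> H; have {}H := H (computable_comp cf (ctxmap_snd0 _ _)).
by apply: computable_ext H => x; rewrite prodr_const_nat subn0.
Qed.

Lemma computable_subq X (cX : context X) (f g : X -> rat) :
  computable f -> computable g -> computable (fun x => f x - g x).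
Proof. by move=> cf cg; apply: computable_addq => //; apply: computable_oppq. Qed.

Lemma computable_ltq X (cX : context X) (f g : X -> rat) :
  computable f -> computable g -> computable (fun x => f x < g x).
Proof.
move=> cf cg; have := computable_negb (computable_rat_ge0 (computable_subq cf cg)).
by apply: computable_ext => x; rewrite subr_ge0 ltNge.
Qed.

Lemma computable_normq X (cX : context X) (f : X -> rat) :
  computable f -> computable (fun x => `|f x|).
Proof.
move=> cf; have := computable_if (computable_rat_ge0 cf) cf (computable_oppq cf).
by apply: computable_ext => x; case: ger0P => // [->|/lt_geF ->].
Qed.

Lemma computable_eqq X (cX : context X) (f g : X -> rat) :
  computable f -> computable g -> computable (fun x => f x == g x).
Proof. by apply: computable_eq; exact: encode_rat_inj. Qed.

Lemma computable_natr X (cX : context X) (n : X -> nat) :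
  computable n -> computable (fun x => (n x)%:R : rat).
Proof.
move=> cn; have := computable_mkrat cn (computable_const 0%N) (computable_const 0%N).
by apply: computable_ext => x; rewrite /mkrat subr0 divr1.
Qed.

(** Picks the closure lemma from the outermost operation of the function. Differences are tried
    before sums, being sums with an opposite. *)
Ltac computable_step :=
  cbv beta;
  lazymatch goal with
  | |- ctxmap snd => exact: ctxmap_snd0
  | |- ctxmap (fun x => x) => exact: ctxmap_id
  | |- ctxmap (fun x => (@?f x, @?h x)) => refine (@ctxmap_pair _ _ _ _ _ _ f h _ _)
  | |- ctxmap (fun x => (@?h x).2) => refine (@ctxmap_snd _ _ _ _ _ _ h _)
  | |- computable (fun _ => ?t) => exact: computable_const
  | |- computable (fun x => (@?f x).+1) => refine (@computable_succ _ _ f _)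
  | |- computable (fun x => addn (@?f x) (@?g x)) => refine (@computable_addn _ _ f g _ _)
  | |- computable (fun x => muln (@?f x) (@?g x)) => refine (@computable_muln _ _ f g _ _)
  | |- computable (fun x => odd (@?f x)) => refine (@computable_odd _ _ f _)
  | |- computable (fun x => size (@?f x)) => refine (@computable_size _ _ _ _ f _)
  | |- computable (fun x => CodeSeq.decode (@?f x)) => refine (@computable_decode _ _ f _)
  | |- computable (fun x => nth _ (@?s x) (@?n x)) => refine (@computable_nth _ _ _ _ _ s n _ _)
  | |- computable (fun x => ~~ @?f x) => refine (@computable_negb _ _ f _)
  | |- computable (fun x => @?f x && @?g x) => refine (@computable_andb _ _ f g _ _)
  | |- computable (fun x => nat_of_bool (@?f x)) => refine (@computable_encoded _ _ _ _ f _)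
  | |- computable (fun x => mkrat (@?p x) (@?n x) (@?d x)) =>
      refine (@computable_mkrat _ _ p n d _ _ _)
  | |- computable (fun x => @GRing.add _ (@?f x) (@GRing.opp _ (@?g x))) =>
      refine (@computable_subq _ _ f g _ _)
  | |- computable (fun x => @GRing.add _ (@?f x) (@?g x)) =>
      refine (@computable_addq _ _ f g _ _)
  | |- computable (fun x => @GRing.mul _ (@?f x) (@?g x)) =>
      refine (@computable_mulq _ _ f g _ _)
  | |- computable (fun x => @GRing.natmul _ _ (@?n x)) => refine (@computable_natr _ _ n _)
  | |- computable (fun x => @GRing.inv _ (@?f x)) => refine (@computable_invq _ _ f _)
  | |- computable (fun x => @GRing.exp _ (@?f x) (@?n x)) =>
      refine (@computable_expq _ _ f n _ _)
  | |- computable (fun x => `|@?f x|) => refine (@computable_normq _ _ f _)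
  | |- computable (fun x => @?f x < @?g x) => refine (@computable_ltq _ _ f g _ _)
  | |- computable (fun x => @eq_op _ (@?f x) (@?g x)) =>
      refine (@computable_eqq _ _ f g _ _)
  | |- computable (fun x => all (@?P x) (iota 0 (@?n x))) =>
      refine (@computable_all _ _ (fun p x => P x p) n _ _)
  | |- computable (fun x => @bigop.body _ _ _ (index_iota 0 (@?n x))
                      (fun i => BigBody i (@GRing.add _) _ (@?F x i))) =>
      refine (@computable_sumq _ _ (fun i x => F x i) n _ _)
  | |- computable (fun x => @bigop.body _ _ _ (index_iota 0 (@?n x))
                      (fun i => BigBody i (@GRing.mul _) _ (@?F x i))) =>
      refine (@computable_prodq _ _ (fun i x => F x i) n _ _)
  | |- computable (fun x => mkseq (fun i => @?F x i) (@?n x)) =>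
      refine (@computable_mkseq _ _ _ _ (fun i x => F x i) n _ _)
  | |- computable (fun x => (@?h x).1) => refine (@computable_fst _ _ _ _ _ _ h _)
  end; cbv beta.

(** A total decoding, with missing entries read as 0, so the certificate search may run over all
    naturals; it is also surjective. *)
Definition natrat (y : nat) : rat :=
  mkrat (nth 0%N (CodeSeq.decode y) 0) (nth 0%N (CodeSeq.decode y) 1)
    (nth 0%N (CodeSeq.decode y) 2).

Definition natvec (y i : nat) : rat := natrat (nth 0%N (CodeSeq.decode y) i).

Definition natmat (y p q : nat) : rat := natvec (nth 0%N (CodeSeq.decode y) p) q.

Lemma computable_natvec X (cX : context X) (f i : X -> nat) :
  computable f -> computable i -> computable (fun x => natvec (f x) (i x)).
Proof. by move=> cf ci; rewrite /natvec /natrat; repeat (computable_step || assumption). Qed.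

Lemma computable_natmat X (cX : context X) (f i j : X -> nat) :
  computable f -> computable i -> computable j ->
  computable (fun x => natmat (f x) (i x) (j x)).
Proof.
move=> cf ci cj; apply: computable_natvec cj.
by repeat (computable_step || assumption).
Qed.

Lemma natrat_surj r : exists y, natrat y = r.
Proof.
exists (CodeSeq.code [:: rat_pos r; rat_neg r; (rat_den r).-1]).
by rewrite /natrat CodeSeq.codeK mkrat_rat.
Qed.

Lemma natvec_surj n (f : nat -> rat) :
  exists y, forall i, (i < n)%N -> natvec y i = f i.
Proof.
have [g Hg] := choice (fun i => natrat_surj (f i)).
exists (CodeSeq.code (mkseq g n)) => i ilt.
by rewrite /natvec CodeSeq.codeK nth_mkseq.
Qed.

Lemma natmat_surj n (f : nat -> nat -> rat) :
  exists y, forall p q, (p < n)%N -> (q < n)%N -> natmat y p q = f p q.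
Proof.
have [g Hg] := choice (fun p => natvec_surj n (f p)).
exists (CodeSeq.code (mkseq g n)) => p q pn qn.
by rewrite /natmat CodeSeq.codeK nth_mkseq ?Hg.
Qed.

(** A code prescribes only finitely many coefficients, and a certificate reads no others. *)
Lemma eq_conv_cert N a n c c' : (forall i, (i < n)%N -> c i = c' i) ->
  conv_cert N a n c = conv_cert N a n c'.
Proof.
move=> cc'; congr (_ && _).
  by congr (_ < _); apply: eq_big_nat => i /= /cc' ->.
apply: eq_all => k; congr (_ == _); by apply: eq_big_nat => i /= /cc' ->.
Qed.

Lemma eq_bilin N a Y Y' :
  (forall p q, (p < N)%N -> (q < N)%N -> Y p q = Y' p q) ->
  bilin N a Y =2 bilin N a Y'.
Proof.
move=> YY' i j; apply: eq_big_nat => p /= pN; apply: eq_big_nat => q /= qN.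
by rewrite YY'.
Qed.

Lemma eq_div_cert N a t Y Y' i j :
  (forall p q, (p < N)%N -> (q < N)%N -> Y p q = Y' p q) ->
  div_cert N a t Y i j = div_cert N a t Y' i j.
Proof.
move=> /(eq_bilin a) YY'; rewrite /div_cert !YY'; congr (_ && _).
by apply: eq_all => p; apply: eq_all => q; rewrite !YY'.
Qed.

(* Codes of certificates: [n; c] for convergence, [t; Y; i; j] for divergence. *)
Definition conv_code N a y : bool :=
  conv_cert N a (nth 0%N (CodeSeq.decode y) 0) (natvec (nth 0%N (CodeSeq.decode y) 1)).

Definition div_code N a y : bool :=
  div_cert N a (odd (nth 0%N (CodeSeq.decode y) 0)) (natmat (nth 0%N (CodeSeq.decode y) 1))
    (nth 0%N (CodeSeq.decode y) 2) (nth 0%N (CodeSeq.decode y) 3).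

Lemma cert_exists N c a : recurs N c a ->
  exists y, conv_code N a y || div_code N a y.
Proof.
move=> ra; have [ta|nta] := pselect (tends0 a).
  have [n [u cu]] := conv_cert_complete ra ta.
  have [y Hy] := natvec_surj n u.
  exists (CodeSeq.code [:: n; y]); apply/orP; left.
  by rewrite /conv_code CodeSeq.codeK /= (eq_conv_cert _ _ Hy).
have [t [Y [i [j cY]]]] := div_cert_complete ra nta.
have [y Hy] := natmat_surj N Y.
exists (CodeSeq.code [:: nat_of_bool t; y; i; j]); apply/orP; right.
by rewrite /div_code CodeSeq.codeK /= oddb (eq_div_cert _ _ _ _ Hy).
Qed.

Section Decision.
Local Open Scope classical_set_scope.
Variables (X : Type) (cX : context X) (N : X -> nat) (a : nat -> X -> rat).
Hypothesis cN : computable N.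
Hypothesis ca : computable (fun p : nat * X => a p.1 p.2).

Let cN_comp Y (cY : context Y) (h : Y -> X) :
  ctxmap h -> computable (fun y => N (h y)).
Proof. exact: computable_comp. Qed.

Let ca_comp Y (cY : context Y) (f : Y -> nat) (h : Y -> X) :
  computable f -> ctxmap h -> computable (fun y => a (f y) (h y)).
Proof.
by move=> cf ch; apply: (computable_comp ca (h := fun y => (f y, h y))); apply: ctxmap_pair.
Qed.

Ltac seq_step :=
  lazymatch goal with
  | |- computable (fun x => a (@?f x) (@?h x)) => refine (@ca_comp _ _ f h _ _)
  | |- computable (fun x => N (@?h x)) => refine (@cN_comp _ _ h _)
  | |- computable (fun x => natvec (@?f x) (@?i x)) =>
      refine (@computable_natvec _ _ f i _ _)
  | |- computable (fun x => natmat (@?f x) (@?i x) (@?j x)) =>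
      refine (@computable_natmat _ _ f i j _ _ _)
  | |- _ => computable_step
  end; cbv beta.

Lemma computable_conv_code : computable (fun p : nat * X => conv_code (N p.2) (a^~ p.2) p.1).
Proof. by rewrite /conv_code /conv_cert; repeat seq_step. Qed.

(** In [div_cert] the form is evaluated under bound indices, hence the arbitrary context [Y] over
    [X]. *)
Lemma computable_bilin Y (cY : context Y) (h : Y -> X) (f i j : Y -> nat) :
  ctxmap h -> computable f -> computable i -> computable j ->
  computable (fun y => bilin (N (h y)) (a^~ (h y)) (natmat (f y)) (i y) (j y)).
Proof.
move=> ch cf ci cj; rewrite /bilin.
repeat seq_step; lazymatch goal with
  | |- computable (fun y => f (@?k y)) => refine (@computable_comp _ _ _ _ _ _ f k cf _)
  | |- computable (fun y => i (@?k y)) => refine (@computable_comp _ _ _ _ _ _ i k ci _)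
  | |- computable (fun y => j (@?k y)) => refine (@computable_comp _ _ _ _ _ _ j k cj _)
  | |- ctxmap (fun y => h (@?k y)) => refine (@ctxmap_comp _ _ _ _ _ _ h k ch _)
  | |- _ => idtac
  end; repeat seq_step => //.
Qed.

Ltac bilin_step := first [ seq_step |
  refine (@computable_bilin _ _ (fun p => _) (fun p => _) (fun p => _) (fun p => _) _ _ _ _);
  cbv beta ].

Lemma computable_div_code : computable (fun p : nat * X => div_code (N p.2) (a^~ p.2) p.1).
Proof.
rewrite /div_code /div_cert; refine (@computable_andb _ _ (fun p => _) (fun p => _) _ _).
  by repeat bilin_step.
refine (@computable_if _ _ _ _ (fun p => odd (nth 0%N (CodeSeq.decode p.1) 0))
  (fun p => bilin _ _ _ _ _ < 0) (fun p => bilin _ _ _ _ _ != 0) _ _ _).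
all: by repeat bilin_step.
Qed.

(** One search returns a certificate; testing its kind decides convergence, and [cert_sum] reads the
    value off it. The checks involve only the order bound and the terms, so mere existence of
    recurrence coefficients suffices. *)
Lemma recurs_series_decidable (R : realType) :
  (forall x, exists c, recurs (N x) c (a^~ x)) ->
  exists (dec : X -> bool) (val : X -> rat), [/\ computable dec, computable val &
    forall x, let s : R^nat := series (fun k => ratr (a k x)) in
      (dec x <-> cvgn s) /\ (cvgn s -> limn s = ratr (val x))].
Proof.
move=> ra.
have [||y cy Hy] := @computable_search _ _ (fun y x =>
    conv_code (N x) (a^~ x) y || div_code (N x) (a^~ x) y).
- exact: computable_orb computable_conv_code computable_div_code.
- by move=> x; have [c rc] := ra x; exact: cert_exists rc.
have cyx : ctxmap (fun x => (y x, x)) by apply: ctxmap_pair cy (ctxmap_id _).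
pose n x := nth 0%N (CodeSeq.decode (y x)) 0.
pose u x i := natvec (nth 0%N (CodeSeq.decode (y x)) 1) i.
exists (fun x => conv_code (N x) (a^~ x) (y x)), (fun x => cert_sum (a^~ x) (n x) (u x)).
split.
- exact: computable_comp computable_conv_code cyx.
- apply: (@computable_comp _ _ _ _ _ _ (fun p : nat * X => cert_sum (a^~ p.2)
    (nth 0%N (CodeSeq.decode p.1) 0) (natvec (nth 0%N (CodeSeq.decode p.1) 1))) _ _ cyx).
  by rewrite /cert_sum /natvec /natrat; repeat seq_step.
move=> x s; have [c rc] := ra x; have [cert _] := Hy x.
have conv : conv_code (N x) (a^~ x) (y x) ->
    s @ \oo --> (ratr (cert_sum (a^~ x) (n x) (u x)) : R).
  exact: conv_cert_cvg rc.
have dec : conv_code (N x) (a^~ x) (y x) <-> cvgn s.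
  split=> [/conv cs|cs]; first by apply: cvgP cs.
  (* A convergent series has terms tending to 0, which excludes a divergence certificate. *)
  case/orP: cert => // cert.
  by case: (div_cert_sound rc cert); exact: cvg_series_tends0 cs.
by split=> // /dec/conv/cvg_lim; apply.
Qed.

End Decision.

(** * Inputs of all dimensions as one type with coded arguments *)

Record input := Input {
  input_dim : nat;
  input_mx : 'M[rat]_input_dim;
  input_vec : 'cV[rat]_input_dim;
  input_terms : terms input_dim;
  input_disc : rat }.

#[global] Instance context_input : context input :=
  @Context input 5
    (fun x => encode_input (input_mx x) (input_vec x) (input_terms x) (input_disc x))
    (fun=> erefl).

(** The codes of this list and the next two are themselves arguments in [encode_input], so a
    projection computes each of them. *)
Definition mat_seq (x : input) : seq rat :=
  [seq input_mx x i j | i <- enum 'I_(input_dim x), j <- enum 'I_(input_dim x)].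

Definition vec_seq (x : input) : seq rat :=
  [seq input_vec x i j | i <- enum 'I_(input_dim x), j <- enum 'I_1].

Definition wt_seq (x : input) : seq (rat * seq nat) :=
  [seq (t.1, tval t.2) | t <- input_terms x].

Lemma computable_dim : computable input_dim.
Proof. by exists (Proj 0) => x; exact: (eval_proj 0). Qed.

Lemma encode_allpairs m n (A : 'M[rat]_(m, n)) :
  encode [seq A i j | i <- enum 'I_m, j <- enum 'I_n] = encode_mx A.
Proof. by rewrite /encode /coded_seq map_allpairs. Qed.

Lemma computable_mat_seq : computable mat_seq.
Proof.
by exists (Proj 1) => x; rewrite encode_allpairs; exact: (eval_proj 1 (args x)).
Qed.

Lemma computable_vec_seq : computable vec_seq.
Proof.
by exists (Proj 2) => x; rewrite encode_allpairs; exact: (eval_proj 2 (args x)).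
Qed.

Lemma computable_wt_seq : computable wt_seq.
Proof.
exists (Proj 3) => x; have -> : encode (wt_seq x) = encode_terms (input_terms x).
  rewrite /encode /coded_seq /wt_seq -map_comp; congr CodeSeq.code.
  by apply: eq_map => t /=; rewrite /encode /coded_pair /= /encode /coded_seq map_id.
exact: (eval_proj 3 (args x)).
Qed.

Lemma computable_disc : computable input_disc.
Proof. by exists (Proj 4) => x; exact: (eval_proj 4 (args x)). Qed.

(** The vector [M^k q], with [M] stored in row-major order. *)
Definition orbit_seq (k : nat) (x : input) : seq rat :=
  iteri k (fun _ v => mkseq (fun i =>
    \sum_(0 <= j < input_dim x) nth 0 (mat_seq x) (i * input_dim x + j) * nth 0 v j)
    (input_dim x)) (vec_seq x).

Lemma nth_allpairs (T U V : Type) (z : V) (x0 : T) (y0 : U) (f : T -> U -> V) s t i j :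
  (i < size s)%N -> (j < size t)%N ->
  nth z [seq f x y | x <- s, y <- t] (i * size t + j) = f (nth x0 s i) (nth y0 t j).
Proof.
elim: s i => // x s IH [|i] /= il jl; rewrite nth_cat size_map.
  by rewrite mul0n add0n jl (nth_map y0).
by rewrite mulSn -addnA ltnNge leq_addr /= addKn IH.
Qed.

Lemma nth_orbit_seq k x (i : 'I_(input_dim x)) :
  nth 0 (orbit_seq k x) i = orbit_coord (input_mx x) (input_vec x) k i.
Proof.
elim: k i => [|k IH] i.
  rewrite /orbit_seq /= /orbit_coord mul1mx.
  have := @nth_allpairs _ _ _ 0 i (0 : 'I_1) (input_vec x) (enum 'I_(input_dim x)) (enum 'I_1) i 0.
  by rewrite -!cardE !card_ord muln1 addn0 => -> //; rewrite nth_ord_enum !ord1.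
rewrite /orbit_seq /= nth_mkseq // -/(orbit_seq k x) orbit_coordS big_mkord.
apply: eq_bigr => j _; rewrite IH; congr (_ * _).
have := @nth_allpairs _ _ _ 0 i i (input_mx x) (enum 'I_(input_dim x)) (enum 'I_(input_dim x)) i j.
by rewrite -!cardE !card_ord => -> //; rewrite !nth_ord_enum.
Qed.

Definition seq_reward (k : nat) (x : input) : rat :=
  \sum_(0 <= t < size (wt_seq x)) (nth (0, [::]) (wt_seq x) t).1 *
    \prod_(0 <= i < input_dim x) nth 0 (orbit_seq k x) i
      ^+ nth 0%N (nth (0, [::]) (wt_seq x) t).2 i.

Lemma seq_rewardE k x : seq_reward k x = rat_reward (input_mx x) (input_vec x) (input_terms x) k.
Proof.
rewrite /rat_reward -[LHS](big_nth (0, [::]) xpredT (fun t => t.1 *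
  \prod_(0 <= i < input_dim x) nth 0 (orbit_seq k x) i ^+ nth 0%N t.2 i)) big_map.
apply: eq_bigr => t _ /=; congr (_ * _); rewrite big_mkord; apply: eq_bigr => i _.
by rewrite nth_orbit_seq -tnth_nth.
Qed.

Ltac input_step :=
  lazymatch goal with
  | |- computable (fun x => input_dim (@?h x)) =>
      refine (@computable_comp _ _ _ _ _ _ input_dim h computable_dim _)
  | |- computable (fun x => input_disc (@?h x)) =>
      refine (@computable_comp _ _ _ _ _ _ input_disc h computable_disc _)
  | |- computable (fun x => mat_seq (@?h x)) =>
      refine (@computable_comp _ _ _ _ _ _ mat_seq h computable_mat_seq _)
  | |- computable (fun x => vec_seq (@?h x)) =>
      refine (@computable_comp _ _ _ _ _ _ vec_seq h computable_vec_seq _)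
  | |- computable (fun x => wt_seq (@?h x)) =>
      refine (@computable_comp _ _ _ _ _ _ wt_seq h computable_wt_seq _)
  | |- computable (fun x => (nth _ (@?s x) (@?n x)).1) =>
      refine (@computable_proj1 _ _ _ _ _ _ _ _)
  | |- computable (fun x => (nth _ (@?s x) (@?n x)).2) =>
      refine (@computable_proj2 _ _ _ _ _ _ _ _)
  | |- _ => computable_step
  end; cbv beta.

Lemma computable_orbit_seq : computable (fun p : nat * input => orbit_seq p.1 p.2).
Proof.
refine (@computable_iteri _ _ _ _ (fun p => p.1) (fun p => vec_seq p.2)
  (fun _ v p => mkseq (fun i => \sum_(0 <= j < input_dim p.2)
     nth 0 (mat_seq p.2) (i * input_dim p.2 + j) * nth 0 v j) (input_dim p.2)) _ _ _).
all: by repeat input_step.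
Qed.

Lemma computable_seq_reward : computable (fun p : nat * input => seq_reward p.1 p.2).
Proof.
rewrite /seq_reward; repeat input_step.
refine (@computable_comp _ _ _ _ _ _ (fun p => orbit_seq p.1 p.2)
  (fun p : nat * (nat * (nat * input)) => (p.2.2.1, p.2.2.2)) computable_orbit_seq _).
by repeat input_step.
Qed.

Definition order_bound (x : input) : nat := ((input_dim x).+1 ^ encode_terms (input_terms x))%N.

Lemma computable_order_bound : computable order_bound.
Proof.
apply: computable_expn; first by repeat input_step.
(* The exponent is an input argument as it stands. *)
by exists (Proj 3) => x; exact: (eval_proj 3 (args x)).
Qed.

Lemma seq_reward_recurs x : exists c, recurs (order_bound x) c (seq_reward^~ x).
Proof.
have [c rc] := rat_reward_recurs (input_mx x) (input_vec x) (input_terms x).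
by exists c; apply: recurs_ext rc => k; exact: seq_rewardE.
Qed.

Theorem theorem23 (R : realType) :
  exists decide_total value_total decide_discounted value_discounted : recfun,
  forall (d : nat) (M : 'M[rat]_d) (q : 'cV[rat]_d) (w : mpoly d rat)
    (ts : terms d) (delta : rat),
    poly_of_terms ts = w -> 0 < delta -> delta < 1 ->
    let input := encode_input M q ts delta in
    let total : R^nat := series (reward R M q w) in
    let discounted : R^nat := series (discounted_reward R M q w delta) in
    [/\ decides decide_total input (cvgn total),
        cvgn total -> computes_rational value_total input (limn total),
        decides decide_discounted input (cvgn discounted)
      & cvgn discounted ->
          computes_rational value_discounted input (limn discounted)].
Proof.
have cdisc : computable (fun p : nat * input => input_disc p.2 ^+ p.1 * seq_reward p.1 p.2).
  by apply: computable_mulq computable_seq_reward; repeat input_step.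
have [dt [vt [[edt Hdt] [evt Hvt] Ht]]] :=
  recurs_series_decidable computable_order_bound computable_seq_reward R seq_reward_recurs.
have [|dd [vd [[edd Hdd] [evd Hvd] Hd]]] := recurs_series_decidable
  (a := fun k x => input_disc x ^+ k * seq_reward k x) computable_order_bound cdisc R.
  by move=> x; have [c rc] := seq_reward_recurs x; eexists; exact: recurs_geom rc.
exists edt, evt, edd, evd => d M q _ ts delta <- _ _ /=.
pose x := Input M q ts delta.
have rE k : reward R M q (poly_of_terms ts) k = ratr (seq_reward k x).
  by rewrite reward_ratr seq_rewardE.
have -> : series (reward R M q (poly_of_terms ts)) = series (fun k => ratr (seq_reward k x)).
  by congr series; apply/funext.
have -> : series (discounted_reward R M q (poly_of_terms ts) delta)
    = series (fun k => ratr (input_disc x ^+ k * seq_reward k x)).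
  by congr series; apply/funext => k; rewrite /discounted_reward rE rmorphM rmorphXn.
have [dtP vtP] := Ht x; have [ddP vdP] := Hd x.
split.
- by exists (dt x); split; first exact: (Hdt x).
- by move=> /vtP ->; exists (vt x); split; last exact: (Hvt x).
- by exists (dd x); split; first exact: (Hdd x).
- by move=> /vdP ->; exists (vd x); split; last exact: (Hvd x).
Qed.
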